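(* Let $n\ge3$, $\alpha\in(0,n)$. Let a generalized condenser $\mathbf A=(A_i)_{i\in I}$ in $\mathbb R^n$ be compact (all $A_i$ compact), and let, for a given $\boldsymbol\sigma\in\mathfrak C(\mathbf A)$, each of the potentials $\kappa_\alpha(\cdot,\sigma^i)$, $i\in I$, be continuous on $A_i$. Then in either Case I or Case II the constrained $\mathbf f$-weighted minimum energy problem is solvable for any given $\mathbf a$ and $\mathbf g$ (i.e. $\mathfrak S^{\boldsymbol\sigma}_{\alpha,\mathbf f}(\mathbf A,\mathbf a,\mathbf g)\neq\varnothing$), and the class $\mathfrak S^{\boldsymbol\sigma}_{\alpha,\mathbf f}(\mathbf A,\mathbf a,\mathbf g)$ of all its solutions is vaguely compact. Furthermore, every minimizing sequence $\{\boldsymbol\mu_k\}_{k\in\mathbb N}$ converges to every $\boldsymbol\lambda\in\mathfrak S^{\boldsymbol\sigma}_{\alpha,\mathbf f}(\mathbf A,\mathbf a,\mathbf g)$ strongly in $\mathcal E^+_\alpha(\mathbf A)$; and hence also vaguely provided that all the $A_i$, $i\in I$, are mutually essentially disjoint (i.e. $c_\alpha(A_i\cap A_j)=0$ for all $i\ne j$).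
   Context: $\kappa_\alpha(x,y)=|x-y|^{\alpha-n}$ on $\mathbb R^n$; $\kappa_\alpha(x,\mu)=\int|x-y|^{\alpha-n}d\mu(y)$, $\kappa_\alpha(\mu,\nu)=\iint|x-y|^{\alpha-n}d\mu(x)d\nu(y)$. ''Continuous'' means continuous with finite real values. $\mathcal E_\alpha(\mathbb R^n)$ is the pre-Hilbert space of signed Radon measures $\mu$ with $\kappa_\alpha(\mu^\pm,\mu^\pm)$ and $\kappa_\alpha(\mu^+,\mu^-)$ finite, with norm $\|\mu\|_\alpha=\sqrt{\kappa_\alpha(\mu,\mu)}$. $c_\alpha(Q)=[\inf\kappa_\alpha(\mu,\mu)]^{-1}$ over positive $\mu\in\mathcal E_\alpha(\mathbb R^n)$ carried by $Q$ with $\mu(Q)=1$. Generalized condenser $\mathbf A=(A_i)_{i\in I}$: $I$ finite, $A_i\subset\mathbb R^n$ nonempty closed with prescribed signs $s_i=\pm1$, $c_\alpha(A_i)>0$ for all $i$, and $c_\alpha(A^+\cap A^-)=0$, where $A^\pm=\bigcup_{s_i=\pm1}A_i$ (equally signed plates may intersect arbitrarily). $\mathfrak M^+(\mathbf A)$: all $\boldsymbol\mu=(\mu^i)_{i\in I}$ with $\mu^i$ a positive Radon measure supported by $A_i$, with the vague topology, i.e. the product topology of componentwise pointwise convergence on $C_0(\mathbb R^n)$, the continuous functions with compact support. $\mathcal E^+_\alpha(\mathbf A)$: those $\boldsymbol\mu$ with $\kappa_\alpha(\mu^i,\mu^i)<\infty$ for all $i$. $R\boldsymbol\mu=\sum_is_i\mu^i$;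 $\kappa_\alpha(\boldsymbol\mu,\boldsymbol\mu)=\sum_{i,j}s_is_j\kappa_\alpha(\mu^i,\mu^j)$. Strong topology/convergence on $\mathcal E^+_\alpha(\mathbf A)$ refers to the semimetric $\|\boldsymbol\mu-\boldsymbol\nu\|_{\mathcal E^+_\alpha(\mathbf A)}=\|R\boldsymbol\mu-R\boldsymbol\nu\|_\alpha$. External field $\mathbf f=(f_i)_{i\in I}$. Case I: every $f_i:\mathbb R^n\to[0,\infty]$ is lower semicontinuous. Case II: $f_i(x)=s_i\kappa_\alpha(x,\zeta)$ for every $i$, with a given (signed) $\zeta\in\mathcal E_\alpha(\mathbb R^n)$. $G_{\alpha,\mathbf f}(\boldsymbol\mu)=\kappa_\alpha(\boldsymbol\mu,\boldsymbol\mu)+2\sum_i\int f_i\,d\mu^i$. $\mathbf a=(a_i)$, $a_i>0$; $\mathbf g=(g_i)$ with $g_i:\mathbb R^n\to(0,\infty)$ continuous and $\inf g_i>0$. $\mathfrak C(\mathbf A)$: all $\boldsymbol\sigma\in\mathfrak M^+(\mathbf A)$ with $\int g_i\,d\sigma^i>a_i$ and support of $\sigma^i$ equal to $A_i$ for all $i$. Admissible class $\mathcal E^{\boldsymbol\sigma}_{\alpha,\mathbf f}(\mathbf A,\mathbf a,\mathbf g)$: all $\boldsymbol\mu\in\mathcal E^+_\alpha(\mathbf A)$ with $G_{\alpha,\mathbf f}(\boldsymbol\mu)$ finite, $\mu^i\le\sigma^i$ and $\int g_i\,d\mu^i=a_i$ for all $i$. $G^{\boldsymbol\sigma}_{\alpha,\mathbf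 f}(\mathbf A,\mathbf a,\mathbf g)$ is the infimum of $G_{\alpha,\mathbf f}$ over this class; standing assumption: it is $<\infty$, i.e. the class is nonempty (it is always $>-\infty$). The constrained $\mathbf f$-weighted minimum energy problem asks whether this infimum is attained; $\mathfrak S^{\boldsymbol\sigma}_{\alpha,\mathbf f}(\mathbf A,\mathbf a,\mathbf g)$ is the set of admissible $\boldsymbol\lambda$ attaining it. A minimizing sequence is a sequence of admissible $\boldsymbol\mu_k$ with $G_{\alpha,\mathbf f}(\boldsymbol\mu_k)\to G^{\boldsymbol\sigma}_{\alpha,\mathbf f}(\mathbf A,\mathbf a,\mathbf g)$. *)

(* Defs.v *)
(* MathComp-Analysis: R^n is 'rV[R]_n, with the topology of the library. *)
From HB Require Import structures.
From mathcomp Require Import all_boot all_order all_algebra.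
From mathcomp Require Import all_classical all_reals all_analysis.

Set Implicit Arguments.
Unset Strict Implicit.
Unset Printing Implicit Defensive.

Import Order.TTheory GRing.Theory Num.Theory.
Import numFieldNormedType.Exports.

Local Open Scope classical_set_scope.
Local Open Scope ring_scope.

(* The Borel sigma-algebra of R^n. *)
HB.instance Definition _ (R : realType) (n : nat) :=
  @isMeasurable.Build (sigma_display (@open 'rV[R]_n)) 'rV[R]_n
    <<s (@open 'rV[R]_n) >> (@sigma_algebra0 _ setT _) (@sigma_algebraC _ _)
    (@sigma_algebra_bigcup _ setT _).

(* On R^n a Borel measure that is finite on compact sets is automatically
   regular, so this is the usual notion of positive Radon measure. *)
Record radon (R : realType) (n : nat) := Radon {
  radon_measure :> {measure set 'rV[R]_n -> \bar R};
  radon_compact : forall K : set 'rV[R]_n, compact K ->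
    (radon_measure K < +oo)%E }.

Section radon_sum.
Context {R : realType} {n : nat}.

Lemma radon0_compact (K : set 'rV[R]_n) : compact K ->
  ((mzero : {measure set 'rV[R]_n -> \bar R}) K < +oo)%E.
Proof. by move=> _; rewrite ltry. Qed.

Definition radon0 : radon R n := Radon radon0_compact.

Lemma radonD_compact (mu nu : radon R n) (K : set 'rV[R]_n) : compact K ->
  ((measure_add mu nu : {measure set 'rV[R]_n -> \bar R}) K < +oo)%E.
Proof.
move=> cK; rewrite (_ : _ K = mu K + nu K)%E; last exact: measure_addE.
by rewrite lte_add_pinfty// radon_compact.
Qed.

Definition radonD (mu nu : radon R n) : radon R n :=
  Radon (@radonD_compact mu nu).

End radon_sum.

(* C_0(R^n) in the Bourbaki sense: continuous with compact support. *)
Record test_function (R : realType) (n : nat) := TestFunction {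
  test_fun :> 'rV[R]_n -> R;
  test_fun_continuous : continuous test_fun;
  test_fun_compact : compact (closure [set x | test_fun x != 0]) }.

Section vague.
Context {R : realType} {n : nat}.

HB.instance Definition _ := gen_eqMixin (test_function R n).
HB.instance Definition _ := gen_choiceMixin (test_function R n).

Definition vague_eval (mu : radon R n) : {ptws test_function R n -> R} :=
  fun phi => \int[mu]_x phi x.

HB.instance Definition _ := gen_eqMixin (radon R n).
HB.instance Definition _ := gen_choiceMixin (radon R n).
(* The vague topology. *)
HB.instance Definition _ :=
  Topological.copy (radon R n) (initial_topology vague_eval).

End vague.

Section riesz.
Context {R : realType} {n : nat}.
Implicit Types (alpha : R) (x y : 'rV[R]_n) (mu nu : radon R n).
Implicit Types Q : set 'rV[R]_n.

(* The norm of 'rV[R]_n in the library is the sup norm. *)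
Definition enorm x : R := Num.sqrt (\sum_(k < n) x ord0 k ^+ 2).

(* The diagonal is treated apart because 0 `^ (alpha - n) = 0. *)
Definition riesz alpha x y : \bar R :=
  if x == y then +oo%E else (enorm (x - y) `^ (alpha - n%:R))%:E.

Definition potential alpha mu x : \bar R := (\int[mu]_y riesz alpha x y)%E.

Definition energy alpha mu nu : \bar R := (\int[mu]_x potential alpha nu x)%E.

(* Used for closed Q only. *)
Definition capacity alpha Q : \bar R :=
  (ereal_inf [set energy alpha mu mu | mu in
    [set mu : radon R n | [/\ energy alpha mu mu < +oo,
                              mu (~` Q) = 0 & mu Q = 1]]])^-1%E.

Definition msupport mu : set 'rV[R]_n :=
  [set x | forall U, open_nbhs x U -> (0 < mu U)%E].

(* A signed Radon measure, given as a formal difference zeta.1 - zeta.2 of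
   positive ones; the quantities below do not depend on the choice of the
   difference as long as all the terms involved are finite. *)
Definition signed_radon := (radon R n * radon R n)%type.
Implicit Types zeta xi : signed_radon.

(* zeta.1 and zeta.2 are the positive and negative parts of zeta.1 - zeta.2. *)
Definition is_jordan zeta := exists P : set 'rV[R]_n,
  [/\ measurable P, zeta.1 (~` P) = 0%E & zeta.2 P = 0%E].

Definition signedB zeta xi : signed_radon :=
  (radonD zeta.1 xi.2, radonD zeta.2 xi.1).

Definition signed_potential alpha zeta x : \bar R :=
  (potential alpha zeta.1 x - potential alpha zeta.2 x)%E.

Definition signed_energy alpha zeta xi : \bar R :=
  (energy alpha zeta.1 xi.1 + energy alpha zeta.2 xi.2
   - energy alpha zeta.1 xi.2 - energy alpha zeta.2 xi.1)%E.

Definition finite_signed_energy alpha zeta := is_jordan zeta /\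
  [/\ (energy alpha zeta.1 zeta.1 < +oo)%E,
      (energy alpha zeta.2 zeta.2 < +oo)%E &
      (energy alpha zeta.1 zeta.2 < +oo)%E].

Definition energy_norm alpha zeta : \bar R := sqrte (signed_energy alpha zeta zeta).

End riesz.

Record condenser (R : realType) (n : nat) (alpha : R) (I : finType) := Condenser {
  plate : I -> set 'rV[R]_n;
  sgn : I -> R;
  sgnP : forall i, sgn i = 1 \/ sgn i = -1;
  plate_nonempty : forall i, plate i !=set0;
  plate_closed : forall i, closed (plate i);
  plate_capacity : forall i, (0 < capacity alpha (plate i))%E;
  plate_intersection : capacity alpha
    ((\bigcup_(i in [set i | sgn i = 1%R]) plate i) `&`
     (\bigcup_(i in [set i | sgn i = -1]) plate i)) = 0%E }.

Section problem.
Context {R : realType} {n : nat} {alpha : R} {I : finType}.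
Variable A : condenser n alpha I.
Implicit Types (mu nu sigma lambda : {ptws I -> radon R n}).
Implicit Types (f : I -> 'rV[R]_n -> \bar R) (g : I -> 'rV[R]_n -> R).
Implicit Types a : I -> R.

Definition plate_measures : set {ptws I -> radon R n} :=
  [set mu | forall i, msupport (mu i) `<=` plate A i].

Definition finite_energy : set {ptws I -> radon R n} :=
  [set mu | plate_measures mu /\
            forall i, (energy alpha (mu i) (mu i) < +oo)%E].

Definition resultant mu : signed_radon :=
  (\big[radonD/radon0]_(i | sgn A i == 1) mu i,
   \big[radonD/radon0]_(i | sgn A i == -1) mu i).

Definition strong_dist mu nu : \bar R :=
  energy_norm alpha (signedB (resultant mu) (resultant nu)).

Definition vector_energy mu : \bar R :=
  (\sum_(i : I) \sum_(j : I)
     (sgn A i * sgn A j)%:E * energy alpha (mu i) (mu j))%E.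

Definition weighted_energy f mu : \bar R :=
  (vector_energy mu + 2%:E * \sum_(i : I) \int[mu i]_x f i x)%E.

Definition case_I f := forall i,
  (forall x, (0 <= f i x)%E) /\ lower_semicontinuous (f i).

(* At the points where the potential of zeta is not defined (the potentials of
   both parts are infinite), the conventions of the library give it a value;
   these points are negligible for every measure of finite energy. *)
Definition case_II f := exists zeta : signed_radon,
  finite_signed_energy alpha zeta /\
  forall i x, f i x = ((sgn A i)%:E * signed_potential alpha zeta x)%E.

Definition weights g := forall i,
  [/\ forall x, 0 < g i x, continuous (g i) & 0 < inf (range (g i))].

Definition constraints a g : set {ptws I -> radon R n} :=
  [set sigma | plate_measures sigma /\
    forall i, ((a i)%:E < \int[sigma i]_x (g i x)%:E)%E /\
              msupport (sigma i) = plate A i].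

Definition admissible f a g sigma : set {ptws I -> radon R n} :=
  [set mu | [/\ finite_energy mu,
    weighted_energy f mu \is a fin_num,
    forall i B, measurable B -> (mu i B <= sigma i B)%E &
    forall i, (\int[mu i]_x (g i x)%:E)%E = (a i)%:E]].

Definition min_energy f a g sigma : \bar R :=
  ereal_inf [set weighted_energy f mu | mu in admissible f a g sigma].

Definition solutions f a g sigma : set {ptws I -> radon R n} :=
  [set lambda | admissible f a g sigma lambda /\
                weighted_energy f lambda = min_energy f a g sigma].

Definition minimizing f a g sigma (mu : nat -> {ptws I -> radon R n}) :=
  (forall k, admissible f a g sigma (mu k)) /\
  weighted_energy f (mu k) @[k --> \oo] --> min_energy f a g sigma.

End problem.

(* Main.v *)
Require Import Defs.
From HB Require Import structures.
From mathcomp Require Import all_boot all_order all_algebra.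
From mathcomp Require Import all_classical all_reals all_analysis.
From mathcomp Require Import measurable_realfun ring lra.

(* Idea.  With beta = (n - alpha)/2, 1/(1+|x|^2) and the like for features v_j
   (inverse stereographic projection), one has |x-y|^2 = (1+|x|^2)(1+|y|^2)(1-u)
   with u(x,y) = sum_j v_j(x) v_j(y) in [0,1].  The binomial series of
   (1-u)^(-beta) then writes the Riesz kernel as a positive combination of
   products phi(x) phi(y) of bounded functions, so that the mutual energy of
   finite measures is a series of products of moments, with nonnegative blocks.
   This gives measurability and symmetry without Fubini, positive definiteness,
   and strict definiteness: if all moments of a compactly supported signed
   measure vanish, then so does the measure.

   The constraint mu^i <= sigma^i makes weak limits elementary: along an
   ultrafilter the values mu^i(B) converge for every Borel set B, and the limit
   is a measure because it is dominated by sigma^i.  The potentials of the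
   sigma^i are bounded (by continuity on A_i and a maximum principle), so the
   terms of the energy series are dominated by those of the sigma^i, and the
   energy is continuous under such limits, while the field term is lower
   semicontinuous.  Hence minimizing ultrafilters converge to solutions.  Strong
   convergence is the parallelogram identity at midpoints; by definiteness all
   solutions have the same resultant, which determines the components when the
   plates are essentially disjoint. *)

(** Positivity of every term of the kernel series carries the argument and dictates the features.
    The scalar product of inverse stereographic projections ranges over [-1,1]; half of one plus it
    lies in [0,1] and is still a scalar product of features. Exchanges of sum and integral are then
    monotone convergence, and the series of the sigma^i majorises term by term. The test functions,
    weight times monomial, are not closed under products. A density argument for their span is
    therefore replaced by one on multipliers, the functions that preserve the property of
    annihilating all tests. In Case II the field may be unbounded below and zeta may have infinite
    mass. The field is split into its two parts: the negative part is integrable for sigma^i and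
    passes to the limit, while the positive part is only lower semicontinuous, which is the right
    direction for a minimum. *)

Set Implicit Arguments.
Unset Strict Implicit.
Unset Printing Implicit Defensive.

Import Order.TTheory GRing.Theory Num.Theory.
Import numFieldNormedType.Exports.

Local Open Scope classical_set_scope.
Local Open Scope ring_scope.

(** * The binomial series *)

Section binomial_series.
Context {R : realType}.
Implicit Types (b t u : R) (k m : nat).

(** The rising factorial b(b+1)...(b+k-1) over k!, that is, the coefficient of t^k in (1-t)^(-b). *)
Definition bincoef b k : R := \prod_(i < k) ((b + i%:R) / i.+1%:R).

Lemma bincoefS b k : k.+1%:R * bincoef b k.+1 = (b + k%:R) * bincoef b k.
Proof.
rewrite /bincoef big_ord_recr/= mulrCA mulrC; congr (_ * _).
by rewrite mulrC divfK// pnatr_eq0.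
Qed.

Lemma bincoef_gt0 b k : 0 < b -> 0 < bincoef b k.
Proof.
move=> b0; apply: prodr_gt0 => i _.
by rewrite divr_gt0// ltr_wpDr.
Qed.

Lemma binterm_ge0 b k t : 0 < b -> 0 <= t -> 0 <= (b + k%:R) * bincoef b k * t ^+ k.
Proof.
move=> b0 t0; apply: mulr_ge0; last exact: exprn_ge0.
by apply: mulr_ge0; [rewrite addr_ge0// ltW|rewrite ltW// bincoef_gt0].
Qed.

Definition binpoly b m : {poly R} := \poly_(k < m.+1) bincoef b k.

Lemma binpolyE b m t : (binpoly b m).[t] = \sum_(k < m.+1) bincoef b k * t ^+ k.
Proof. exact: horner_poly. Qed.

Lemma binpoly0 b m : (binpoly b m).[0] = 1.
Proof. by rewrite horner_coef0 coef_poly /bincoef big_ord0. Qed.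

Lemma binpolyS b m :
  binpoly b m.+1 = binpoly b m + (bincoef b m.+1) *: 'X^(m.+1).
Proof. by rewrite /binpoly !poly_def big_ord_recr. Qed.

(** The full series solves (1-t) p' = b p. For its truncation the recurrence [bincoefS] cancels all
    coefficients except the top one. *)
Lemma binpoly_deriv b m t :
  (1 - t) * (binpoly b m)^`().[t] - b * (binpoly b m).[t] =
  - ((b + m%:R) * bincoef b m * t ^+ m).
Proof.
elim: m => [|m IH].
  rewrite /binpoly poly_def big_ord1 /= expr0 alg_polyC derivC !hornerE /=.
  ring.
rewrite binpolyS derivD derivZ derivXn !hornerE.
rewrite hornerMn hornerXn -[_ *+ _]mulr_natl.
have H := bincoefS b m.
have -> : (b + m.+1%:R) * bincoef b m.+1 * t ^+ m.+1 =
   (b + m.+1%:R) * bincoef b m.+1 * t ^+ m * t by rewrite exprSr mulrA.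
transitivity ((1 - t) * (binpoly b m)^`().[t] - b * (binpoly b m).[t]
  + (1 - t) * (m.+1%:R * bincoef b m.+1 * t ^+ m)
  - b * (bincoef b m.+1 * (t ^+ m * t))).
  by rewrite exprS /=; ring.
rewrite IH H.
transitivity (- (t * (m.+1%:R * bincoef b m.+1 * t ^+ m)) - b * bincoef b m.+1 * t ^+ m * t).
  rewrite H; ring.
ring.
Qed.

(** For the full series this product would be constantly 1; for the truncation its derivative is the
    remainder term alone. *)
Definition bintest b m t := (1 - t) `^ b * (binpoly b m).[t].

Lemma bintest_derive b m t : t < 1 -> is_derive t 1 (bintest b m)
  (- ((1 - t) `^ (b - 1) * ((b + m%:R) * bincoef b m * t ^+ m))).
Proof.
move=> t1.
have t10 : 0 < 1 - t by rewrite subr_gt0.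
have d0 : is_derive t 1 (fun t : R => 1 - t) (-1).
  have -> : (fun t : R => 1 - t) = (cst 1 : R -> R) - id by [].
  by apply: is_derive_eq; rewrite sub0r.
have d1 : is_derive t 1 (fun t : R => (1 - t) `^ b) (- (b * (1 - t) `^ (b - 1))).
  have dd := is_derive1_comp (f := fun x : R => x `^ b) (g := fun t : R => 1 - t)
    (is_derive1_powR b t10) d0.
  by apply: (is_derive_eq dd); rewrite mulrN1.
have d2 := @is_derive_poly R (binpoly b m) t.
have := @is_deriveM _ _ _ _ _ _ _ _ d1 d2.
move=> d; apply: (is_derive_eq d).
rewrite /GRing.scale /=.
have E : (1 - t) `^ b = (1 - t) * (1 - t) `^ (b - 1).
  rewrite -[in LHS](subrK 1 b) (@powRD _ _ (b - 1) 1); last by rewrite (gt_eqF t10) implybT.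
  by rewrite powRr1 1?mulrC// ltW.
rewrite E.
have := binpoly_deriv b m t.
rewrite (_ : (1 - t) * (1 - t) `^ (b - 1) * (binpoly b m)^`().[t] =
  (1 - t) `^ (b - 1) * ((1 - t) * (binpoly b m)^`().[t])); last by ring.
move=> /eqP; rewrite subr_eq => /eqP ->; ring.
Qed.

(** Mean value form of the remainder: its sign gives the upper bound [binpoly_le], its size the
    limit [binpoly_cvg]. *)
Lemma bintest_MVT b m u : 0 < u < 1 -> exists2 x, 0 < x < u &
  bintest b m u = 1 - (1 - x) `^ (b - 1) * ((b + m%:R) * bincoef b m * x ^+ m) * u.
Proof.
move=> /andP[u0 u1].
have [||x] := @MVT R (bintest b m)
   (fun t => - ((1 - t) `^ (b - 1) * ((b + m%:R) * bincoef b m * t ^+ m))) 0 u u0.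
- move=> x; rewrite in_itv/= => /andP[_ xu]; apply: bintest_derive.
  exact: lt_trans xu _.
- apply: derivable_within_continuous => x; rewrite in_itv/= => /andP[_ xu].
  by have [] := @bintest_derive b m x (le_lt_trans xu u1).
rewrite in_itv/= => xu; rewrite subr0 => /eqP; rewrite subr_eq => /eqP E.
exists x => //; rewrite E.
by rewrite /bintest subr0 powR1 mul1r binpoly0; ring.
Qed.

Lemma binpoly_le b m u : 0 < b -> 0 <= u < 1 -> (binpoly b m).[u] <= (1 - u) `^ (- b).
Proof.
move=> b0 /andP[]; rewrite le_eqVlt => /predU1P[<- _|u0 u1].
  by rewrite binpoly0 subr0 powR1.
have := @bintest_MVT b m u; rewrite u0 u1 => /(_ isT)[x /andP[x0 xu] E].
have u10 : 0 < (1 - u) `^ b by rewrite powR_gt0// subr_gt0.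
rewrite powRN -[leRHS]mulr1 ler_pdivlMl//.
rewrite -/(bintest b m u) E lerBlDr lerDl.
apply: mulr_ge0; last exact: ltW.
by apply: mulr_ge0; [exact: powR_ge0|apply: binterm_ge0 => //; exact: ltW].
Qed.

(** Because 1 - s^m = (1-s)(1 + ... + s^(m-1)), where each of the m summands is at least s^m. *)
Lemma natr_expr_le (s : R) m : 0 <= s < 1 -> m%:R * s ^+ m <= (1 - s)^-1.
Proof.
move=> /andP[s0 s1].
have s10 : 0 < 1 - s by rewrite subr_gt0.
rewrite -[leRHS]mulr1 ler_pdivlMl//.
apply: (@le_trans _ _ (1 - s ^+ m)); last by rewrite gerBl exprn_ge0.
elim: m => [|m IH]; first by rewrite mul0r mulr0 expr0 subrr.
have sm : 0 <= s ^+ m by rewrite exprn_ge0.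
have sm1 : s ^+ m.+1 <= 1 by rewrite exprn_ile1 // ltW.
have := ler_wpM2l s0 IH; have : 0 <= (1 - s) * (1 - s ^+ m.+1).
  by rewrite mulr_ge0 ?subr_ge0// ltW.
rewrite -natr1 !exprS; lra.
Qed.

Lemma binpoly_cvg b u : 0 < b -> 0 <= u < 1 ->
  (binpoly b m).[u] @[m --> \oo] --> (1 - u) `^ (- b).
Proof.
move=> b0 /andP[]; rewrite le_eqVlt => /predU1P[<- _|u0 u1].
  apply: cvg_near_cst; apply: nearW => m.
  by rewrite binpoly0 subr0 powR1.
have u01 : 0 < u < 1 by rewrite u0.
have u10 : 0 < 1 - u by rewrite subr_gt0.
(* A cube root of u: of the three factors s^m of u^m, one absorbs the linear factor b + m, one
   absorbs [bincoef b m], and the last tends to 0. *)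
set s := u `^ (3%:R^-1).
have sE : u = s ^+ 3 by rewrite /s -powR_mulrn ?powR_ge0// -powRrM mulVf ?powRr1 ?ltW ?pnatr_eq0.
have s0 : 0 < s by rewrite powR_gt0.
have s1 : s < 1.
  by rewrite -(@ltr_pXn2r _ 3) ?nnegrE ?ltW// -sE expr1n.
have s01 : 0 <= s < 1 by rewrite ltW.
pose C := (1 - u)^-1 * ((b + (1 - s)^-1) * (1 - s) `^ (- b)).
have lo m : (1 - u) `^ (- b) * (1 - C * s ^+ m) <= (binpoly b m).[u].
  have [x /andP[x0 xu] E] := bintest_MVT b m u01.
  have u1b : 0 < (1 - u) `^ b by rewrite powR_gt0.
  rewrite powRN ler_pdivrMl// -/(bintest b m u) E.
  rewrite lerD2l lerN2.
  have x1 : x < 1 by exact: lt_trans xu _.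
  have -> : C * s ^+ m = (1 - u)^-1 * ((b + (1 - s)^-1) * (1 - s) `^ (- b) * s ^+ m) * 1.
    by rewrite /C; ring.
  apply: ler_pM; [|exact: ltW| |exact: ltW].
    by apply: mulr_ge0; [exact: powR_ge0|apply: binterm_ge0 => //; exact: ltW].
  apply: ler_pM; first exact: powR_ge0.
  - by apply: binterm_ge0 => //; exact: ltW.
  - have x10 : 0 < 1 - x by rewrite subr_gt0.
    (* Splitting off (1-x)^(-1) treats b < 1 and b >= 1 alike. *)
    rewrite (@powRB _ _ b 1); last by rewrite (gt_eqF x10) implybT.
    rewrite powRr1 ?(ltW x10)//; apply: (@le_trans _ _ (1 - x)^-1).
      rewrite ler_piMl ?invr_ge0 ?(ltW x10)//.
      by rewrite -[leRHS](powRr0 (1 - x)) ger_powR ?(ltW b0)// x10 gerBl ltW.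
    by rewrite lef_pV2 ?posrE// lerD2l lerN2 ltW.
  apply: (@le_trans _ _ ((b + m%:R) * bincoef b m * u ^+ m)).
    apply: ler_wpM2l.
      by apply: mulr_ge0; [rewrite addr_ge0// ltW|rewrite ltW// bincoef_gt0].
    by apply: lerXn2r; rewrite ?nnegrE ltW.
  rewrite sE -exprM mulnC (_ : (m * 3)%N = (m + m + m)%N); last by rewrite mulnC !mulSn mul0n addn0 addnA.
  rewrite !exprD.
  have -> : (b + m%:R) * bincoef b m * (s ^+ m * s ^+ m * s ^+ m) =
    ((b + m%:R) * s ^+ m) * (bincoef b m * s ^+ m) * s ^+ m by ring.
  have sm : 0 <= s ^+ m by rewrite exprn_ge0 // ltW.
  have cm : 0 <= bincoef b m by rewrite ltW ?bincoef_gt0.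
  apply: ler_wpM2r => //; apply: ler_pM.
  - by rewrite mulr_ge0// addr_ge0// ltW.
  - exact: mulr_ge0.
  - rewrite mulrDl lerD ?natr_expr_le//.
    by rewrite ler_piMr ?(ltW b0)// exprn_ile1// ltW.
  (* The term of degree m at s is at most the whole polynomial, hence at most (1-s)^(-b). *)
  apply: le_trans (binpoly_le m b0 s01).
  rewrite binpolyE big_ord_recr/= lerDr sumr_ge0// => i _.
  by apply: mulr_ge0; [rewrite ltW// bincoef_gt0|rewrite exprn_ge0// ltW].
apply: (@squeeze_cvgr _ _ _ _ (fun m => (1 - u) `^ (- b) * (1 - C * s ^+ m)) (cst ((1 - u) `^ (- b)))).
- by apply: nearW => m; rewrite lo binpoly_le// u1 ltW.
- rewrite -[X in _ --> X]mulr1; apply: cvgM; first exact: cvg_cst.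
  rewrite -[X in _ --> X]subr0; apply: cvgB; first exact: cvg_cst.
  rewrite -(mulr0 C); apply: cvgM; first exact: cvg_cst.
  by apply: cvg_expr; rewrite ger0_norm// ltW.
- exact: cvg_cst.
Qed.

End binomial_series.

(** * Expansion of the Riesz kernel *)

Section feature_kernel.
Context {R : realType} {n : nat}.
Implicit Types (x y : 'rV[R]_n).

Definition sqn x : R := \sum_(k < n) x ord0 k ^+ 2.

Lemma sqn_ge0 x : 0 <= sqn x.
Proof. by apply: sumr_ge0 => k _; exact: sqr_ge0. Qed.

Lemma sqn1_gt0 x : 0 < 1 + sqn x.
Proof. by rewrite ltr_wpDr ?sqn_ge0. Qed.

Lemma sqn_eq0 x : (sqn x == 0) = (x == 0).
Proof.
apply/eqP/eqP => [x0|->]; last by rewrite /sqn big1// => k _; rewrite mxE expr0n.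
apply/rowP => k; rewrite mxE.
have /(_ k isT)/eqP := psumr_eq0P (fun k _ => sqr_ge0 (x ord0 k)) x0.
by rewrite sqrf_eq0 => /eqP.
Qed.

(** The squares sum to 1, so the features map R^n into a unit sphere; their scalar product is (1 +
    S(x).S(y))/2 with S the inverse stereographic projection. *)
Definition feature (j : bool + 'I_n) x : R :=
  match j with
  | inl b => (if b then 1 else sqn x) / (1 + sqn x)
  | inr k => Num.sqrt 2 * x ord0 k / (1 + sqn x)
  end.

Definition feature_ker x y : R := \sum_j feature j x * feature j y.

Let inner x y := \sum_(k < n) x ord0 k * y ord0 k.

Let inner_combE (s t : R) x y : \sum_(k < n) (s * x ord0 k + t * y ord0 k) ^+ 2 =
  s ^+ 2 * sqn x + 2 * s * t * inner x y + t ^+ 2 * sqn y.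
Proof.
rewrite /sqn /inner !mulr_sumr -!big_split/=.
by apply: eq_bigr => k _; ring.
Qed.

Let sqnBE x y : sqn (x - y) = sqn x - 2 * inner x y + sqn y.
Proof.
have := inner_combE 1 (-1) x y; rewrite expr1n mul1r sqrrN expr1n mul1r => E.
rewrite (_ : sqn x - _ + _ = sqn x + 2 * 1 * -1 * inner x y + sqn y); last by ring.
by rewrite -E; apply: eq_bigr => k _; rewrite !mxE; ring.
Qed.

Let feature_kerE x y : feature_ker x y =
  (1 + sqn x * sqn y + 2 * inner x y) / ((1 + sqn x) * (1 + sqn y)).
Proof.
have qx := lt0r_neq0 (sqn1_gt0 x); have qy := lt0r_neq0 (sqn1_gt0 y).
rewrite /feature_ker big_sumType/= big_bool/=.
rewrite (eq_bigr (fun k => 2 / ((1 + sqn x) * (1 + sqn y)) * (x ord0 k * y ord0 k))).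
  rewrite -mulr_sumr -/(inner x y). 
  by move: (sqn x) (sqn y) (inner x y) qx qy => p q r qx qy; field; rewrite qx qy.
move=> k _; have := @sqr_sqrtr R 2 (ler0n _ _); move: (Num.sqrt 2) => r <-.
by move: (sqn x) (sqn y) qx qy => p q qx qy; field; rewrite qx qy.
Qed.

Lemma feature_ker1B x y :
  1 - feature_ker x y = sqn (x - y) / ((1 + sqn x) * (1 + sqn y)).
Proof.
have qx := lt0r_neq0 (sqn1_gt0 x); have qy := lt0r_neq0 (sqn1_gt0 y).
rewrite feature_kerE sqnBE.
by move: (sqn x) (sqn y) (inner x y) qx qy => p q r qx qy; field; rewrite qx qy.
Qed.

(** Times |y|^2, the numerator 1 + |x|^2 |y|^2 + 2 x.y is the squared length of |y|^2 x + y; the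
    case y = 0 is direct. *)
Lemma feature_ker_ge0 x y : 0 <= feature_ker x y.
Proof.
rewrite feature_kerE divr_ge0 ?mulr_ge0 ?(ltW (sqn1_gt0 _))//.
have [y0|y0] := eqVneq (sqn y) 0.
  move/eqP: (y0); rewrite sqn_eq0 => /eqP ->.
  rewrite /inner big1 => [|k _]; last by rewrite mxE mulr0.
  by rewrite mulr0 addr0 addr_ge0// mulr_ge0// sqn_ge0.
have y1 : 0 < sqn y by rewrite lt_def y0 sqn_ge0.
have := inner_combE (sqn y) 1 x y.
have : 0 <= \sum_(k < n) (sqn y * x ord0 k + 1 * y ord0 k) ^+ 2.
  by apply: sumr_ge0 => k _; exact: sqr_ge0.
move=> /[swap] ->; rewrite -(pmulr_rge0 _ y1); congr (0 <= _); ring.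
Qed.

Lemma feature_ker_lt1 x y : x != y -> feature_ker x y < 1.
Proof.
move=> xy; rewrite -subr_gt0 feature_ker1B divr_gt0 ?mulr_gt0 ?sqn1_gt0//.
by rewrite lt_def sqn_ge0 sqn_eq0 subr_eq0 xy.
Qed.

Lemma feature_ker_diag x : feature_ker x x = 1.
Proof.
apply/esym/eqP; rewrite -subr_eq0 feature_ker1B mulf_eq0 sqn_eq0 subrr.
by rewrite eqxx.
Qed.

Definition monomial k (w : {ffun 'I_k -> bool + 'I_n}) x : R :=
  \prod_i feature (w i) x.

(** A power of a finite sum of separated products is again one, indexed by words; this lets double
    integrals factor. *)
Lemma feature_kerX k x y : feature_ker x y ^+ k =
  \sum_(w : {ffun 'I_k -> bool + 'I_n}) monomial w x * monomial w y.
Proof.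
rewrite -[k in LHS]card_ord -prodr_const bigA_distr_bigA/=.
by apply: eq_bigr => w _; rewrite -big_split.
Qed.

Lemma feature_le1 j x : `|feature j x| <= 1.
Proof.
rewrite -(@ler_pXn2r _ 2)// ?nnegrE// expr1n -normrX ger0_norm ?sqr_ge0//.
rewrite -(feature_ker_diag x) /feature_ker (bigD1 j)//= expr2 lerDl.
by apply: sumr_ge0 => i _; rewrite -expr2 sqr_ge0.
Qed.

Lemma monomial_le1 k (w : {ffun 'I_k -> bool + 'I_n}) x : `|monomial w x| <= 1.
Proof.
rewrite normr_prod -[leRHS](@big1_eq _ 1 *%R _ (index_enum 'I_k) predT).
by apply: ler_prod => i _; rewrite normr_ge0 feature_le1.
Qed.

Lemma sqn_enorm x : enorm x = Num.sqrt (sqn x). Proof. by []. Qed.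

(** Times [weight b x * weight b y], the function (1-u)^(-b) becomes |x-y|^(-2b). *)
Definition weight (b : R) x : R := (1 + sqn x) `^ (- b).

Lemma weight_gt0 b x : 0 < weight b x.
Proof. by rewrite powR_gt0// sqn1_gt0. Qed.

Lemma weight_le1 b x : 0 <= b -> weight b x <= 1.
Proof.
move=> b0; rewrite -(powRr0 (1 + sqn x)) ler_powR ?lerDl ?sqn_ge0//.
by rewrite oppr_le0.
Qed.

End feature_kernel.

Section riesz_expansion.
Context {R : realType} {n : nat}.
Variable alpha : R.
Hypothesis alphan : alpha < n%:R.
Implicit Types (x y : 'rV[R]_n).

Definition half_codim : R := (n%:R - alpha) / 2.
Let b := half_codim.

Lemma half_codim_gt0 : 0 < b.
Proof. by rewrite divr_gt0// subr_gt0. Qed.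

Definition rterm k x y : R :=
  bincoef b k * (weight b x * weight b y * feature_ker x y ^+ k).

Lemma rterm_ge0 k x y : 0 <= rterm k x y.
Proof.
apply: mulr_ge0; first by rewrite ltW ?bincoef_gt0 ?half_codim_gt0.
by rewrite !mulr_ge0 ?exprn_ge0 ?feature_ker_ge0 // ltW ?weight_gt0.
Qed.

Let partialE m x y : (\sum_(0 <= k < m.+1) (rterm k x y)%:E)%E =
  (weight b x * weight b y * (binpoly b m).[feature_ker x y])%:E.
Proof.
rewrite sumEFin; congr EFin; rewrite big_mkord binpolyE mulr_sumr.
by apply: eq_bigr => k _; rewrite /rterm mulrCA.
Qed.

Lemma riesz_sqn x y : x != y -> riesz alpha x y = (sqn (x - y) `^ (- b))%:E.
Proof.
move=> xy; rewrite /riesz (negbTE xy) sqn_enorm -powR12_sqrt ?sqn_ge0// -powRrM.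
by congr (_ `^ _)%:E; rewrite /b /half_codim; field.
Qed.

(** Off the diagonal u < 1 and this is the binomial series; on it u = 1 and the series diverges to
    the value +oo of the kernel there. *)
Lemma rieszE x y : riesz alpha x y = (\sum_(0 <= k <oo) (rterm k x y)%:E)%E.
Proof.
have [<-{y}|xy] := eqVneq x y; last first.
  rewrite riesz_sqn//; have u1 := feature_ker_lt1 xy.
  apply/esym/cvg_lim => //; rewrite -(cvg_shiftS _).
  under eq_fun do rewrite partialE.
  apply: cvg_EFin; first exact: nearW.
  rewrite (_ : sqn (x - y) `^ (- b) =
      weight b x * weight b y * (1 - feature_ker x y) `^ (- b)).
    apply: cvgM; first exact: cvg_cst.
    by apply: binpoly_cvg; rewrite ?half_codim_gt0// feature_ker_ge0 u1.
  rewrite feature_ker1B /weight.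
  rewrite powRM ?sqn_ge0 ?invr_ge0 ?mulr_ge0 ?(ltW (sqn1_gt0 _))//.
  rewrite -powR_inv1 ?mulr_ge0 ?(ltW (sqn1_gt0 _))// -powRrM mulrC.
  rewrite mulN1r opprK -!powRM ?(ltW (sqn1_gt0 _))//.
  rewrite -mulrA -powRD.
    by rewrite subrr powRr0 mulr1.
  by rewrite mulf_neq0 ?implybT// lt0r_neq0 ?sqn1_gt0.
rewrite /riesz eqxx; apply/esym/eqyP => M M0.
pose w := weight b x * weight b x.
have w0 : 0 < w by rewrite mulr_gt0 ?weight_gt0.
have b0 := half_codim_gt0.
(* Chosen so that d^(-b) = 1 + M / w: some polynomial exceeds M / w at 1 - d, and its value at 1 is
   at least as large. *)
pose d := (1 + M / w) `^ (- b^-1).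
have Mw0 : 0 < 1 + M / w by rewrite addr_gt0// divr_gt0.
have d0 : 0 < d by rewrite powR_gt0.
have d1 : d <= 1.
  rewrite -(powRr0 (1 + M / w)) ler_powR ?oppr_le0 ?invr_ge0 ?(ltW b0)//.
  by rewrite lerDl divr_ge0 ?ltW.
have dM : d `^ (- b) = 1 + M / w.
  by rewrite -powRrM mulrNN mulVf ?gt_eqF// powRr1 ?ltW.
have u01 : 0 <= 1 - d < 1 by rewrite subr_ge0 d1 gtrBl d0.
have := binpoly_cvg b0 u01; rewrite subKr dM => /cvgrPdist_lt /(_ 1 ltr01)[m _ /(_ m (leqnn _))].
move=> /= Hm; have {}Hm : M / w < (binpoly b m).[1 - d].
  by move: Hm; rewrite ltr_distlC => /andP[+ _]; lra.
apply: le_trans (nneseries_lim_ge m.+1 _); last by move=> k _ _; rewrite lee_fin rterm_ge0.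
rewrite partialE -/w lee_fin -ler_pdivrMl// mulrC; apply: (le_trans (ltW Hm)).
rewrite feature_ker_diag !binpolyE; apply: ler_sum => k _.
rewrite ler_wpM2l ?(ltW (bincoef_gt0 _ _))// expr1n exprn_ile1//.
  by case/andP: u01.
by rewrite gerBl ltW.
Qed.

End riesz_expansion.

(** * Bounded measurable functions against finite measures *)

Section bounded_measurable.
Context {d} {T : measurableType d} {R : realType}.
Implicit Types (h : T -> R) (mu : {measure set T -> \bar R}).

Definition bounded_measurable h :=
  measurable_fun setT h /\ exists C, forall x, `|h x| <= C.

Lemma bounded_measurable_cst (c : R) : bounded_measurable (fun=> c).
Proof. by split; [exact: measurable_cst|exists `|c|]. Qed.

Lemma bounded_measurableD h1 h2 : bounded_measurable h1 ->
  bounded_measurable h2 -> bounded_measurable (fun x => h1 x + h2 x).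
Proof.
move=> [m1 [C1 b1]] [m2 [C2 b2]]; split; first exact: measurable_funD.
by exists (C1 + C2) => x; rewrite (le_trans (ler_normD _ _))// lerD.
Qed.

Lemma bounded_measurableM h1 h2 : bounded_measurable h1 ->
  bounded_measurable h2 -> bounded_measurable (fun x => h1 x * h2 x).
Proof.
move=> [m1 [C1 b1]] [m2 [C2 b2]]; split; first exact: measurable_funM.
by exists (C1 * C2) => x; rewrite normrM ler_pM.
Qed.

Lemma bounded_measurable_integrable mu h : (mu setT < +oo)%E ->
  bounded_measurable h -> mu.-integrable setT (EFin \o h).
Proof.
move=> muT [mh [C hC]]; apply: measurable_bounded_integrable => //.
by exists C; split; [exact: num_real|move=> M CM x _; exact: le_trans (hC x) (ltW CM)].
Qed.

Lemma integral_lincomb mu (J : finType) (c : J -> R) (h : J -> T -> R) :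
  (mu setT < +oo)%E -> (forall j, bounded_measurable (h j)) ->
  (\int[mu]_x (\sum_j c j * h j x)%:E)%E =
  (\sum_j c j * \int[mu]_x h j x)%:E.
Proof.
move=> muT hb; under eq_integral do rewrite -sumEFin.
rewrite integral_sum//; last first.
  move=> j; apply: (bounded_measurable_integrable muT).
  exact: bounded_measurableM (bounded_measurable_cst _) (hb j).
rewrite -sumEFin; apply: eq_bigr => j _.
have ij := bounded_measurable_integrable muT (hb j).
under eq_integral do rewrite EFinM.
rewrite integralZl// EFinM; congr (_ * _)%E.
by rewrite /Rintegral fineK// integrable_fin_num.
Qed.

End bounded_measurable.

(** * Borel measurability on R^n *)

Section borel.
Context {R : realType} {n : nat}.
Implicit Types (x y : 'rV[R]_n) (mu nu : radon R n).

Lemma measurable_open (U : set 'rV[R]_n) : open U -> measurable U.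
Proof. exact: sub_sigma_algebra. Qed.

Lemma measurable_closed (U : set 'rV[R]_n) : closed U -> measurable U.
Proof.
by move=> cU; rewrite -[U]setCK; apply: measurableC; apply: measurable_open; exact: closed_openC.
Qed.

Lemma continuous_measurable_rV (f : 'rV[R]_n -> R) :
  continuous f -> measurable_fun setT f.
Proof.
move=> cf; apply: (measurability (@RGenOInfty.G R)).
  exact: RGenOInfty.measurableE.
move=> _ [_ [r ->] <-]; rewrite setTI; apply: measurable_open.
by apply: open_comp => // x _; exact: cf.
Qed.

Lemma measurable_coord (k : 'I_n) : measurable_fun setT (fun x => x ord0 k).
Proof. by apply: continuous_measurable_rV; exact: coord_continuous. Qed.

Lemma measurable_sqn : measurable_fun setT (@sqn R n).
Proof.
apply: measurable_sum => k; under eq_fun do rewrite expr2.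
by apply: measurable_funM; exact: measurable_coord.
Qed.

Lemma measurable_weight b : measurable_fun setT (@weight R n b).
Proof.
apply: (measurableT_comp (measurable_powR (- b))).
by apply: measurable_funD => //; exact: measurable_sqn.
Qed.

Lemma measurable_feature j : measurable_fun setT (@feature R n j).
Proof.
have mi : measurable_fun setT (fun x : 'rV[R]_n => (1 + sqn x)^-1).
  under eq_fun do rewrite -powR_inv1 ?(ltW (sqn1_gt0 _))//.
  exact: measurable_weight.
case: j => [[]|k] /=; apply: measurable_funM => //; first exact: measurable_sqn.
by apply: measurable_funM => //; exact: measurable_coord.
Qed.

Lemma bounded_measurable_weight b : 0 <= b -> bounded_measurable (@weight R n b).
Proof.
move=> b0; split; first exact: measurable_weight.
by exists 1 => x; rewrite ger0_norm ?weight_le1// ltW// weight_gt0.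
Qed.

Lemma bounded_measurable_monomial k (w : {ffun 'I_k -> bool + 'I_n}) :
  bounded_measurable (@monomial R n k w).
Proof.
split; last by exists 1 => x; exact: monomial_le1.
by apply: measurable_prod => i _; exact: measurable_feature.
Qed.

End borel.

(** * Potentials and energies as series of moments *)

Section energy_expansion.
Context {R : realType} {n : nat}.
Variable alpha : R.
Hypothesis alphan : alpha < n%:R.
Implicit Types (x y : 'rV[R]_n) (mu nu : radon R n).
Let b := half_codim (n := n) alpha.

Definition test k (w : {ffun 'I_k -> bool + 'I_n}) x : R :=
  weight b x * monomial w x.

Lemma bounded_measurable_test k w : bounded_measurable (@test k w).
Proof.
apply: bounded_measurableM (bounded_measurable_monomial w).
by apply: bounded_measurable_weight; rewrite ltW// half_codim_gt0.
Qed.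

Definition moment mu k (w : {ffun 'I_k -> bool + 'I_n}) : R :=
  \int[mu]_x test w x.

(** The double integral of [rterm k], which splits over words into products of moments. *)
Definition eterm k mu nu : R :=
  bincoef b k * \sum_(w : {ffun 'I_k -> bool + 'I_n}) moment mu w * moment nu w.

Let rtermE k x y : rterm alpha k x y =
  \sum_(w : {ffun 'I_k -> bool + 'I_n}) (bincoef b k * test w x) * test w y.
Proof.
rewrite /rterm feature_kerX !mulr_sumr; apply: eq_bigr => w _.
by rewrite /test -/b; ring.
Qed.

Let pterm k nu x : R := \sum_(w : {ffun 'I_k -> bool + 'I_n})
  (bincoef b k * moment nu w) * test w x.

Let integral_rterm k nu x : (nu setT < +oo)%E ->
  (\int[nu]_y (rterm alpha k x y)%:E)%E = (pterm k nu x)%:E.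
Proof.
move=> nuT; under eq_integral do rewrite rtermE.
rewrite integral_lincomb//; last by move=> w; exact: bounded_measurable_test.
by congr EFin; apply: eq_bigr => w _; rewrite mulrAC.
Qed.

Let pterm_ge0 k nu x : (nu setT < +oo)%E -> 0 <= pterm k nu x.
Proof.
move=> nuT; rewrite -lee_fin -integral_rterm//; apply: integral_ge0 => y _.
by rewrite lee_fin rterm_ge0.
Qed.

Let measurable_pterm k nu : measurable_fun setT (pterm k nu).
Proof.
apply: measurable_sum => w; apply: measurable_funM => //.
by have [] := bounded_measurable_test w.
Qed.

Let potentialE nu x : (nu setT < +oo)%E ->
  potential alpha nu x = (\sum_(0 <= k <oo) (pterm k nu x)%:E)%E.
Proof.
move=> nuT; rewrite /potential; under eq_integral do rewrite rieszE//.
rewrite integral_nneseries//.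
- by apply: eq_eseriesr => k _; rewrite integral_rterm.
- move=> k; apply/measurable_EFinP; rewrite (funext (rtermE k x)).
  apply: measurable_sum => w; apply: measurable_funM => //.
  by have [] := bounded_measurable_test w.
- by move=> k y _; rewrite lee_fin rterm_ge0.
Qed.

Lemma measurable_potential nu : (nu setT < +oo)%E ->
  measurable_fun setT (potential alpha nu).
Proof.
move=> nuT; rewrite (funext (fun x => potentialE x nuT)).
apply: ge0_emeasurable_sum => [k x _ _|k _]; first by rewrite lee_fin pterm_ge0.
by apply/measurable_EFinP; exact: measurable_pterm.
Qed.

Let integral_pterm k mu nu : (mu setT < +oo)%E ->
  (\int[mu]_x (pterm k nu x)%:E)%E = (eterm k mu nu)%:E.
Proof.
move=> muT; rewrite integral_lincomb//; last by move=> w; exact: bounded_measurable_test.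
congr EFin; rewrite /eterm mulr_sumr; apply: eq_bigr => w _.
by rewrite -mulrA [moment nu w * _]mulrC.
Qed.

(** For different mu and nu the products of moments have no sign; the iterated integral of the
    nonnegative [rterm] has. *)
Lemma eterm_ge0 k mu nu : (mu setT < +oo)%E -> (nu setT < +oo)%E ->
  0 <= eterm k mu nu.
Proof.
move=> muT nuT; rewrite -lee_fin -integral_pterm//; apply: integral_ge0 => x _.
by rewrite lee_fin pterm_ge0.
Qed.

(** Monotonicity is invisible on the moments, which are signed; it is read off the iterated
    integral, one measure at a time. *)
Lemma eterm_le k mu mu' nu nu' :
  (mu' setT < +oo)%E -> (nu' setT < +oo)%E ->
  (forall B, measurable B -> (mu B <= mu' B)%E) ->
  (forall B, measurable B -> (nu B <= nu' B)%E) ->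
  eterm k mu nu <= eterm k mu' nu'.
Proof.
move=> mu'T nu'T mumu' nunu'.
have muT : (mu setT < +oo)%E by rewrite (le_lt_trans (mumu' _ measurableT)).
have nuT : (nu setT < +oo)%E by rewrite (le_lt_trans (nunu' _ measurableT)).
rewrite -lee_fin -!integral_pterm//.
apply: (@le_trans _ _ (\int[mu]_x (pterm k nu' x)%:E)%E).
  apply: ge0_le_integral => //.
  - by move=> x _; rewrite lee_fin pterm_ge0.
  - by apply/measurable_EFinP; exact: measurable_pterm.
  - by apply/measurable_EFinP; exact: measurable_pterm.
  - move=> x _; rewrite -!integral_rterm//; apply: ge0_le_measure_integral => //.
      by move=> y; rewrite lee_fin rterm_ge0.
    apply/measurable_EFinP; rewrite (funext (rtermE k x)).
    apply: measurable_sum => w; apply: measurable_funM => //.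
    by have [] := bounded_measurable_test w.
apply: ge0_le_measure_integral => //.
  by move=> x; rewrite lee_fin pterm_ge0.
by apply/measurable_EFinP; exact: measurable_pterm.
Qed.

Lemma measurable_riesz x : measurable_fun setT (riesz alpha x).
Proof.
rewrite (funext (rieszE alphan x)).
apply: ge0_emeasurable_sum => [k y _ _|k _]; first by rewrite lee_fin rterm_ge0.
apply/measurable_EFinP; rewrite (funext (rtermE k x)).
apply: measurable_sum => w; apply: measurable_funM => //.
by have [] := bounded_measurable_test w.
Qed.

Lemma energyE mu nu : (mu setT < +oo)%E -> (nu setT < +oo)%E ->
  energy alpha mu nu = (\sum_(0 <= k <oo) (eterm k mu nu)%:E)%E.
Proof.
move=> muT nuT; rewrite /energy; under eq_integral do rewrite potentialE//.
rewrite integral_nneseries//.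
- by apply: eq_eseriesr => k _; rewrite integral_pterm.
- by move=> k; by apply/measurable_EFinP; exact: measurable_pterm.
- by move=> k x _; rewrite lee_fin pterm_ge0.
Qed.

Lemma etermC k mu nu : eterm k mu nu = eterm k nu mu.
Proof. by congr (_ * _); apply: eq_bigr => w _; rewrite mulrC. Qed.

Lemma energyC mu nu : (mu setT < +oo)%E -> (nu setT < +oo)%E ->
  energy alpha mu nu = energy alpha nu mu.
Proof.
move=> muT nuT; rewrite !energyE//; apply: eq_eseriesr => k _.
by rewrite etermC.
Qed.

End energy_expansion.

(** * Setwise limits of dominated measures *)

Section tannery.
Context {R : realType}.
Implicit Types u v : R^nat.

Lemma nneseries_EFin u : (forall k, 0 <= u k) ->
  (\sum_(0 <= k <oo) (u k)%:E < +oo)%E ->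
  cvgn (series u) /\ (\sum_(0 <= k <oo) (u k)%:E)%E = (limn (series u))%:E.
Proof.
move=> u0 fin.
have u0' k : (0 <= k)%N -> true -> (0 <= (u k)%:E)%E by rewrite lee_fin.
have nd : nondecreasing_seq (series u).
  by apply/nondecreasing_seqP => k; rewrite /series/= big_nat_recr//= lerDl.
have cu : cvgn (series u).
  apply: nondecreasing_is_cvgn => //.
  exists (fine (\sum_(0 <= k <oo) (u k)%:E)%E) => _ [m _ <-].
  rewrite -lee_fin fineK; last first.
    by rewrite ge0_fin_numE// nneseries_ge0.
  by rewrite /series/= -sumEFin; exact: nneseries_lim_ge.
split=> //; apply/cvg_lim => //.
under eq_fun do rewrite sumEFin.
by apply: cvg_EFin; [exact: nearW|exact: cu].
Qed.

(** The difference of the partial sums is nondecreasing, so the tail of u is at most that of v. This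
    bound does not depend on u, as [tannery] requires. *)
Lemma cvg_series_tail u v : (forall k, 0 <= u k <= v k) -> cvgn (series v) ->
  cvgn (series u) /\
  forall m, series u m <= limn (series u) <= series u m + (limn (series v) - series v m).
Proof.
move=> uv cv.
have ndu : nondecreasing_seq (series u).
  apply/nondecreasing_seqP => k; rewrite /series/= big_nat_recr//= lerDl.
  by case/andP: (uv k).
have ndB : nondecreasing_seq (series v \- series u).
  apply/nondecreasing_seqP => k; rewrite /series/= !big_nat_recr//=.
  by have /andP[_ ?] := uv k; lra.
have cu : cvgn (series u).
  apply: nondecreasing_is_cvgn => //; exists (limn (series v)) => _ [m _ <-].
  have ndv : nondecreasing_seq (series v).
    apply/nondecreasing_seqP => k; rewrite /series/= big_nat_recr//= lerDl.
    by have /andP[? ?] := uv k; lra.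
  apply: le_trans (nondecreasing_cvgn_le ndv cv m).
  rewrite /series/=; apply: ler_sum => k _.
  by case/andP: (uv k).
split => // m; rewrite nondecreasing_cvgn_le//=.
have cB : (series v \- series u) m @[m --> \oo] --> limn (series v) - limn (series u).
  exact: cvgB.
have := nondecreasing_cvgn_le ndB (cvgP _ cB) m.
by rewrite (cvg_lim _ cB)//=; lra.
Qed.

(** Dominated convergence for series along an arbitrary filter: finitely many terms converge, and
    the tails are bounded uniformly by the tail of M. *)
Lemma tannery X (F : set_system X) (a : X -> R^nat) (l M : R^nat) :
  ProperFilter F -> (\forall x \near F, forall k, 0 <= a x k <= M k) ->
  cvgn (series M) -> (forall k, a x k @[x --> F] --> l k) ->
  cvgn (series l) /\ limn (series (a x)) @[x --> F] --> limn (series l).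
Proof.
move=> FF aM cM al.
have lM k : 0 <= l k <= M k.
  rewrite -(cvg_lim _ (al k))//; apply/andP; split.
    by apply: limr_ge; [exact: cvgP (al k)|apply: filterS aM => x /(_ k)/andP[]].
  by apply: limr_le; [exact: cvgP (al k)|apply: filterS aM => x /(_ k)/andP[]].
have [cl tl] := cvg_series_tail lM cM; split => //.
apply/cvgrPdist_lt => e e0.
have e2 : 0 < e / 2 by rewrite divr_gt0.
have /cvgrPdist_lt /(_ _ e2)[m _ /(_ m (leqnn m)) /= tM] := cM.
have sal : series (a x) m @[x --> F] --> series l m.
  rewrite /series/=; apply: (cvg_big _ (P := xpredT)) => //; exact: add_continuous.
have /cvgrPdist_lt /(_ _ e2) sal2 := sal.
near=> x.
have aMx : forall k, 0 <= a x k <= M k by near: x.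
have [_ /(_ m) /andP[t1 t2]] := cvg_series_tail aMx cM.
have /andP[t3 t4] := tl m.
have : `|series l m - series (a x) m| < e / 2 by near: x.
move: tM; rewrite !ltr_norml; lra.
Unshelve. all: by end_near. Qed.

Lemma tanneryE X (F : set_system X) (a : X -> R^nat) (l M : R^nat) :
  ProperFilter F -> (\forall x \near F, forall k, 0 <= a x k <= M k) ->
  (\sum_(0 <= k <oo) (M k)%:E < +oo)%E -> (forall k, a x k @[x --> F] --> l k) ->
  (\sum_(0 <= k <oo) (a x k)%:E)%E @[x --> F] --> (\sum_(0 <= k <oo) (l k)%:E)%E.
Proof.
move=> FF aM Moo al.
have M0 k : 0 <= M k.
  have [x /(_ k)] : exists x, forall k, 0 <= a x k <= M k by exact: filter_ex aM.
  by move=> /andP[a1 a2]; exact: le_trans a2.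
have [cM _] := nneseries_EFin M0 Moo.
have fin u : (forall k, 0 <= u k <= M k) ->
    (\sum_(0 <= k <oo) (u k)%:E)%E = (limn (series u))%:E.
  move=> uM; have [||_ -> //] := @nneseries_EFin u.
    by move=> k; case/andP: (uM k).
  apply: le_lt_trans Moo; apply: lee_nneseries => k _; rewrite ?lee_fin.
    by case/andP: (uM k).
  by case/andP: (uM k).
have lM k : 0 <= l k <= M k.
  rewrite -(cvg_lim _ (al k))//; apply/andP; split.
    by apply: limr_ge; [exact: cvgP (al k)|apply: filterS aM => x /(_ k)/andP[]].
  by apply: limr_le; [exact: cvgP (al k)|apply: filterS aM => x /(_ k)/andP[]].
have [_ cal] := tannery FF aM cM al.
rewrite (fin l)//; apply: cvg_EFin.
  by near=> x; rewrite fin//; near: x.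
apply: cvg_trans cal; apply: near_eq_cvg.
by near=> x; rewrite /= fin//; near: x.
Unshelve. all: by end_near. Qed.

End tannery.

(** * Limits along ultrafilters *)

Section ultrafilter_limits.
Context {R : realType} {X : Type} (F : set_system X).
Hypothesis FU : UltraFilter F.

(** The image of F extends to an ultrafilter G, which converges in K. As F is ultra, a neighbourhood
    whose preimage is not in F would have its complement in G. *)
Lemma ultra_compact_cvg (T : topologicalType) (K : set T) (h : X -> T) :
  compact K -> (\forall x \near F, K (h x)) ->
  exists2 l, K l & h x @[x --> F] --> l.
Proof.
move=> cK hK; have FF := @ultra_proper _ _ FU.
have [G [GU FG]] := ultraFilterLemma (fmap_proper_filter h FF).
move: cK; rewrite compact_ultra => /(_ G GU).
have GK : G K by exact: FG.
move=> /(_ GK)[l [Kl Gl]]; exists l => // N lN.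
have [//|FN] := in_ultra_setVsetC (h @^-1` N) FU.
have GN : G (~` N) by exact: FG.
have GPF := @ultra_proper _ _ GU.
have G0 : G set0 by rewrite -(setICr N); exact: (@filterI _ G _ N (~` N) (Gl _ lN) GN).
by have := @filter_not_empty _ G GPF G0.
Qed.

End ultrafilter_limits.

Section setwise_limit.
Context {d} {T : measurableType d} {R : realType} {X : Type} (F : set_system X).
Hypothesis FU : UltraFilter F.
Let FF : ProperFilter F := @ultra_proper _ _ FU.
Variables (m : X -> {measure set T -> \bar R}) (S : {measure set T -> \bar R}).
Hypothesis S_fin : (S setT < +oo)%E.
Hypothesis dom : \forall x \near F, forall B, measurable B -> (m x B <= S B)%E.

Let Sfin B : measurable B -> (S B < +oo)%E.
Proof. by move=> mB; rewrite (le_lt_trans _ S_fin)// le_measure// inE. Qed.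

Let dom_fin : \forall x \near F, forall B, measurable B ->
  m x B = (fine (m x B))%:E /\ 0 <= fine (m x B) <= fine (S B).
Proof.
apply: filterS dom => x H B mB.
have Bf : (m x B \is a fin_num)%E.
  by rewrite ge0_fin_numE// (le_lt_trans (H _ mB))// Sfin.
by rewrite fineK//; split => //; rewrite fine_ge0// fine_le// ?ge0_fin_numE ?Sfin ?H.
Qed.

Let value_cvg B : measurable B -> exists2 l, 0 <= l <= fine (S B) &
  fine (m x B) @[x --> F] --> l.
Proof.
move=> mB; have := @ultra_compact_cvg X F FU R `[0, fine (S B)]%classic (fun x => fine (m x B)).
move=> /(_ (@segment_compact _ _ _))[|l]; last by rewrite /= in_itv/= => ? ?; exists l.
by apply: filterS dom_fin => x /(_ _ mB)[_]; rewrite /= in_itv.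
Qed.

(** Countable additivity of the limit is Tannery's theorem: the masses of disjoint A_i are dominated
    by S(A_i), whose sum is finite. *)
Lemma setwise_limit : exists mu : {measure set T -> \bar R},
  forall B, measurable B -> (mu B <= S B)%E /\ m x B @[x --> F] --> mu B.
Proof.
pose l B := lim (fine (m x B) @[x --> F]).
have lP B : measurable B -> 0 <= l B <= fine (S B) /\ fine (m x B) @[x --> F] --> l B.
  move=> mB; have [r r0 cr] := value_cvg mB.
  by have -> : l B = r by exact: cvg_lim.
(* Limits are only known on measurable sets, while a measure must be nonnegative on every set; hence
   the value 0 elsewhere. *)
pose mu B : \bar R := if `[< measurable B >] then (l B)%:E else 0%E.
have muE B : measurable B -> mu B = (l B)%:E by move=> mB; rewrite /mu asboolT.
have mu0 : mu set0 = 0%E.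
  rewrite muE//; have [+ _] := lP _ measurable0.
  by rewrite measure0/= => l0; congr EFin; apply/eqP; rewrite eq_le andbC.
have mu_ge0 B : (0 <= mu B)%E.
  rewrite /mu; case: ifPn => // /asboolP mB; rewrite lee_fin.
  by have [/andP[]] := lP _ mB.
have mu_sa : semi_sigma_additive mu.
  move=> A mA tA mUA; rewrite muE//.
  rewrite (_ : (fun _ => _) = fun k => (\sum_(0 <= i < k) (l (A i))%:E)%E); last first.
    by apply/funext => k; apply: eq_bigr => i _; rewrite muE.
  have cS : (\sum_(0 <= i <oo) (fine (S (A i)))%:E)%E = S (\bigcup_i A i).
    rewrite measure_semi_bigcup//; apply: eq_eseriesr => i _.
    by rewrite fineK// ge0_fin_numE ?Sfin.
  have dA : \forall x \near F, forall i, 0 <= fine (m x (A i)) <= fine (S (A i)).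
    by apply: filterS dom_fin => x H i; have [] := H _ (mA i).
  have cA i : fine (m x (A i)) @[x --> F] --> l (A i) by have [] := lP _ (mA i).
  have ct := tanneryE FF dA _ cA.
  have {}ct : (\sum_(0 <= k <oo) (fine (m x (A k)))%:E)%E @[x --> F] -->
      (\sum_(0 <= k <oo) (l (A k))%:E)%E by apply: ct; rewrite cS Sfin.
  have -> : (l (\bigcup_i A i))%:E = (\sum_(0 <= k <oo) (l (A k))%:E)%E.
    apply: (cvg_unique (@ereal_hausdorff R)) ct => /=.
    have [_ cU] := lP _ mUA.
    have cU' : (fine (m x (\bigcup_i A i)))%:E @[x --> F] --> (l (\bigcup_i A i))%:E.
      by apply: cvg_EFin; [exact: nearW|exact: cU].
    apply: cvg_trans cU'; apply: near_eq_cvg.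
    apply: filterS dom_fin => x H; have [<- _] := H _ mUA.
    rewrite measure_semi_bigcup//; apply: eq_eseriesr => i _.
    by have [] := H _ (mA i).
  apply: is_cvg_nneseries => i _ _; rewrite lee_fin.
  by have [/andP[]] := lP _ (mA i).
pose mmix := isMeasure.Build d T R mu mu0 mu_ge0 mu_sa.
pose muM : {measure set T -> \bar R} := HB.pack mu mmix.
exists muM => B mB; rewrite /= muE//; have [/andP[l0 lS] cl] := lP _ mB.
split; first by rewrite -(fineK (x := S B)) ?lee_fin// ge0_fin_numE ?Sfin.
apply: cvg_EFin; last exact: cl.
by apply: filterS dom_fin => x /(_ _ mB)[-> _].
Qed.

Variable mu : {measure set T -> \bar R}.
Hypothesis muS : forall B, measurable B -> (mu B <= S B)%E.
Hypothesis mu_lim : forall B, measurable B -> m x B @[x --> F] --> mu B.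

Import HBNNSimple.

Lemma cvg_integral_nnsfun (h : {nnsfun T >-> R}) :
  (\int[m x]_y (h y)%:E)%E @[x --> F] --> (\int[mu]_y (h y)%:E)%E.
Proof.
under eq_fun do rewrite integralT_nnsfun sintegralE fsbig_finite//=.
rewrite integralT_nnsfun sintegralE fsbig_finite//=.
apply: cvg_nnesum => r _.
  apply: nearW => x; have [r0|r0] := leP 0 r; first by rewrite mule_ge0.
  rewrite (_ : _ @^-1` _ = set0) ?measure0 ?mule0//.
  by apply/seteqP; split => // y /= hr; move: r0; rewrite -hr ltNge => /negP[].
by apply: cvgeZl => //; apply: mu_lim; exact: measurable_funPTI.
Qed.

Section nonnegative.
Variable h : T -> \bar R.
Hypothesis h_ge0 : forall y, (0 <= h y)%E.
Hypothesis mh : measurable_fun setT h.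
Let h_ k : {nnsfun T >-> R} := nnsfun_approx measurableT mh k.

Let le_h_ k y : ((h_ k y)%:E <= h y)%E.
Proof. by rewrite /h_ nnsfun_approxE le_approx. Qed.

Let integral_h_ (nu : {measure set T -> \bar R}) :
  (\int[nu]_y (h_ k y)%:E)%E @[k --> \oo] --> (\int[nu]_y h y)%E.
Proof.
rewrite (_ : (\int[nu]_y h y)%E = (\int[nu]_y (limn (fun k => (h_ k y)%:E)))%E).
  apply: cvg_monotone_convergence => //.
  - by move=> k; apply/measurable_EFinP.
  - by move=> k y _; rewrite lee_fin.
  - by move=> y _ a b ab; rewrite lee_fin; exact/lefP/nd_nnsfun_approx.
by apply: eq_integral => y _; apply/esym/cvg_lim => //; exact: cvg_nnsfun_approx.
Qed.

(** Fatou's lemma: h itself is not dominated, but the simple functions below it pass to the limit,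
    and monotone convergence then recovers h. *)
Lemma integral_setwise_le (C : \bar R) :
  (\forall x \near F, \int[m x]_y h y <= C)%E -> (\int[mu]_y h y <= C)%E.
Proof.
move=> hC; apply: (cvge_to_le (@integral_h_ mu)); apply: nearW => k.
apply: (cvge_to_le (@cvg_integral_nnsfun (h_ k))); apply: filterS hC => x.
apply: le_trans; apply: ge0_le_integral => //.
- by move=> y _; rewrite lee_fin.
- by apply/measurable_EFinP.
Qed.

(** For every nu <= S the integral of h - h_k against nu is at most the one against S, so the
    approximation error is uniformly small along F. *)
Lemma cvg_integral_setwise : (\int[S]_y h y < +oo)%E ->
  (\int[m x]_y h y)%E @[x --> F] --> (\int[mu]_y h y)%E.
Proof.
move=> hS.
pose g k y := (h y - (h_ k y)%:E)%E.
have g0 k y : (0 <= g k y)%E by rewrite sube_ge0.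
have mg k : measurable_fun setT (g k).
  by apply: emeasurable_funB => //; apply/measurable_EFinP.
have split_h k (nu : {measure set T -> \bar R}) :
    (\int[nu]_y h y = \int[nu]_y g k y + \int[nu]_y (h_ k y)%:E)%E.
  rewrite -ge0_integralD//.
  - by apply: eq_integral => y _; rewrite /g subeK.
  - by move=> y _; rewrite lee_fin.
  - by apply/measurable_EFinP.
have dominated (nu : {measure set T -> \bar R}) : (forall B, measurable B -> nu B <= S B)%E ->
    forall k', (0 <= fine (\int[nu]_y h y) - fine (\int[nu]_y (h_ k' y)%:E)
      <= fine (\int[S]_y h y) - fine (\int[S]_y (h_ k' y)%:E)) /\
      (\int[nu]_y h y \is a fin_num)%E /\ (\int[nu]_y (h_ k' y)%:E \is a fin_num)%E.
  move=> nuS k.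
  have nuh : (\int[nu]_y h y < +oo)%E.
    by rewrite (le_lt_trans _ hS)//; exact: ge0_le_measure_integral.
  have fh (nu' : {measure set T -> \bar R}) : (\int[nu']_y h y < +oo ->
      \int[nu']_y h y \is a fin_num /\ \int[nu']_y g k y \is a fin_num /\
      \int[nu']_y (h_ k y)%:E \is a fin_num)%E.
    move=> H.
    have i0 : (0 <= \int[nu']_y (h_ k y)%:E)%E by apply: integral_ge0 => y _; rewrite lee_fin.
    have i1 : (0 <= \int[nu']_y g k y)%E by exact: integral_ge0.
    have H' : (\int[nu']_y g k y + \int[nu']_y (h_ k y)%:E < +oo)%E by rewrite -split_h.
    have ih : (0 <= \int[nu']_y h y)%E by exact: integral_ge0.
    rewrite !ge0_fin_numE//; split=> //; split; apply: le_lt_trans H'.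
      by rewrite leeDl.
    by rewrite leeDr.
  have [n1 [n2 n3]] := fh _ nuh; have [s1 [s2 s3]] := fh _ hS.
  split => //; rewrite !(split_h k) (fineD n2 n3) (fineD s2 s3).
  have := fine_le n2 s2 (ge0_le_measure_integral nuS measurableT (g0 k) (mg k)).
  have : 0 <= fine (\int[nu]_y g k y)%E by rewrite fine_ge0// integral_ge0.
  by move: (fine _) (fine _) (fine _) (fine _) => p q r t; lra.
have mu_fin := (dominated _ muS 0%N).2.1.
rewrite -(fineK mu_fin); apply: cvg_EFin.
  by apply: filterS dom => x /dominated /(_ 0%N)[_ []].
apply/cvgrPdist_lt => e e0.
have e3 : 0 < e / 3 by rewrite divr_gt0.
have S_h := @integral_h_ S.
have hS_fin := (dominated S (fun _ _ => lexx _) 0%N).2.1.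
move: S_h; rewrite -(fineK hS_fin) => /fine_cvgP[_ /cvgrPdist_lt /(_ _ e3)[k _ /(_ k (leqnn k)) /=]].
move=> tS.
have := @cvg_integral_nnsfun (h_ k).
rewrite -[X in _ --> X]fineK; last exact: (dominated _ muS k).2.2.
move=> /fine_cvgP[_ /cvgrPdist_lt /(_ _ e3) sim].
near=> x.
have domx : (forall B, measurable B -> m x B <= S B)%E by near: x.
have [/andP[a1 a2] _] := dominated _ domx k.
have [/andP[a3 a4] _] := dominated _ muS k.
have : `|fine (\int[mu]_y (h_ k y)%:E)%E - fine (\int[m x]_y (h_ k y)%:E)%E| < e / 3.
  by near: x.
move: tS; rewrite !ltr_norml/=; lra.
Unshelve. all: by end_near. Qed.

End nonnegative.

Lemma cvg_Rintegral_setwise (h : T -> R) : bounded_measurable h ->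
  (\int[m x]_y h y) @[x --> F] --> \int[mu]_y h y.
Proof.
move=> bh; have [mh [C hC]] := bh.
(* The shift by a bound makes the function nonnegative; convergence of the total masses undoes
   it. *)
pose h' y := (h y + `|C|)%:E.
have bh' : bounded_measurable (fun y => h y + `|C|).
  by apply: bounded_measurableD => //; exact: bounded_measurable_cst.
have h'0 y : (0 <= h' y)%E.
  by rewrite lee_fin -lerBlDr sub0r (le_trans _ (lerNnormlW (hC y)))// lerN2 ler_norm.
have mh' : measurable_fun setT h' by apply/measurable_EFinP; have [] := bh'.
have E (nu : {measure set T -> \bar R}) : (nu setT < +oo)%E ->
    \int[nu]_y h y = fine (\int[nu]_y h' y)%E - `|C| * fine (nu setT).
  move=> nuT; have := @RintegralD _ _ _ nu setT h (fun=> `|C|) measurableT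
    (bounded_measurable_integrable nuT bh)
    (bounded_measurable_integrable nuT (bounded_measurable_cst `|C|)).
  rewrite Rintegral_cst// => E; apply/eqP; rewrite eq_sym subr_eq -E.
  by [].
have mufin : (mu setT < +oo)%E by rewrite (le_lt_trans (muS measurableT)).
rewrite E//.
have c1 : (fine (\int[m x]_y h' y)%E - `|C| * fine (m x setT)) @[x --> F] -->
    (fine (\int[mu]_y h' y)%E - `|C| * fine (mu setT)).
  have h'S : (\int[S]_y h' y < +oo)%E.
    have /integrableP[_] := bounded_measurable_integrable S_fin bh'.
    by apply: le_lt_trans; apply: ge0_le_integral => //; [exact/measurableT_comp|move=> y _; exact: lee_abs].
  apply: cvgB.
    apply: fine_cvg; rewrite fineK; first exact: cvg_integral_setwise.
    rewrite ge0_fin_numE ?integral_ge0//; apply: le_lt_trans h'S.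
    exact: ge0_le_measure_integral.
  apply: cvgM; first exact: cvg_cst.
  by apply: fine_cvg; rewrite fineK ?ge0_fin_numE//; exact: mu_lim.
apply: cvg_trans c1; apply: near_eq_cvg.
by apply: filterS dom => x domx; rewrite E// (le_lt_trans (domx _ measurableT)).
Qed.

End setwise_limit.

(** * Measures with bounded potential *)

Section tame_measures.
Context {R : realType} {n : nat}.
Variable alpha : R.
Hypothesis alphan : alpha < n%:R.
Implicit Types (x y : 'rV[R]_n) (mu nu eta : radon R n).
Local Notation potential := (potential alpha).
Local Notation energy := (energy alpha).

Definition dominated mu nu := forall B, measurable B -> (mu B <= nu B)%E.

(** A class stable under domination, sums and scaling in which mutual energies are finite, so that
    energies can be computed in the reals through [mutual]. *)
Definition tame mu :=
  (mu setT < +oo)%E /\ exists C : R, forall x, (potential mu x <= C%:E)%E.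

Lemma riesz_ge0 x y : (0 <= riesz alpha x y)%E.
Proof. by rewrite /riesz; case: ifP => // _; rewrite lee_fin powR_ge0. Qed.

Lemma potential_ge0 mu x : (0 <= potential mu x)%E.
Proof. by apply: integral_ge0 => y _; exact: riesz_ge0. Qed.

Lemma energy_ge0 mu nu : (0 <= energy mu nu)%E.
Proof. by apply: integral_ge0 => y _; exact: potential_ge0. Qed.

Let mriesz := measurable_riesz alphan.

Lemma potential_le mu nu x : dominated mu nu -> (potential mu x <= potential nu x)%E.
Proof.
move=> munu; apply: ge0_le_measure_integral => //; exact: riesz_ge0.
Qed.

Lemma tame_dominated mu nu : dominated mu nu -> tame nu -> tame mu.
Proof.
move=> munu [nuT [C nuC]]; split; first by rewrite (le_lt_trans (munu _ measurableT)).
by exists C => x; rewrite (le_trans (potential_le x munu)).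
Qed.

Lemma tame_energy_fin mu nu : tame mu -> tame nu -> energy mu nu \is a fin_num.
Proof.
move=> [muT _] [nuT [C nuC]]; rewrite ge0_fin_numE ?energy_ge0//.
apply: (@le_lt_trans _ _ (\int[mu]_x (Num.max C 0)%:E)%E).
  apply: ge0_le_integral => //.
  - by move=> x _; exact: potential_ge0.
  - exact: measurable_potential.
  - by move=> x _; rewrite (le_trans (nuC x))// lee_fin le_max lexx.
by rewrite integral_cst// lte_mul_pinfty// lee_fin le_max lexx orbT.
Qed.

Lemma potentialD mu nu x :
  potential (radonD mu nu) x = (potential mu x + potential nu x)%E.
Proof.
apply: ge0_integral_measure_add => //.
by move=> y _; exact: riesz_ge0.
Qed.

Lemma energyD mu nu eta : (eta setT < +oo)%E ->
  energy (radonD mu nu) eta = (energy mu eta + energy nu eta)%E.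
Proof.
move=> etaT; apply: ge0_integral_measure_add => //; last exact: measurable_potential.
by move=> y _; exact: potential_ge0.
Qed.

Lemma tameD mu nu : tame mu -> tame nu -> tame (radonD mu nu).
Proof.
move=> [muT [C muC]] [nuT [D nuD]]; split.
  by rewrite [X in (X < _)%E]measure_addE lte_add_pinfty.
by exists (C + D) => x; rewrite potentialD EFinD leeD.
Qed.

Lemma tame0 : tame (@radon0 R n).
Proof.
split; first by rewrite /= /mzero ltry.
by exists 0 => x; rewrite /potential integral_measure_zero.
Qed.

Lemma radonZ_compact (c : {nonneg R}) mu (K : set 'rV[R]_n) : compact K ->
  ((mscale c mu : {measure set 'rV[R]_n -> \bar R}) K < +oo)%E.
Proof. by move=> cK; rewrite /= /mscale lte_mul_pinfty// radon_compact. Qed.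

Definition radonZ c mu : radon R n := Radon (@radonZ_compact c mu).

Lemma potentialZ c mu x :
  potential (radonZ c mu) x = (c%:num%:E * potential mu x)%E.
Proof.
apply: ge0_integral_mscale => //.
by move=> y _; exact: riesz_ge0.
Qed.

Lemma energyZ c mu eta : (eta setT < +oo)%E ->
  energy (radonZ c mu) eta = (c%:num%:E * energy mu eta)%E.
Proof.
move=> etaT; apply: ge0_integral_mscale => //; first exact: measurable_potential.
by move=> y _; exact: potential_ge0.
Qed.

Lemma tameZ c mu : tame mu -> tame (radonZ c mu).
Proof.
move=> [muT [C muC]]; split; first by rewrite /= /mscale lte_mul_pinfty.
exists (c%:num * C) => x; rewrite potentialZ EFinM lee_pmul ?potential_ge0//.
Qed.

Definition mutual mu nu : R := fine (energy mu nu).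

Lemma mutualE mu nu : tame mu -> tame nu -> energy mu nu = (mutual mu nu)%:E.
Proof. by move=> tmu tnu; rewrite fineK// tame_energy_fin. Qed.

Lemma mutualC mu nu : tame mu -> tame nu -> mutual mu nu = mutual nu mu.
Proof. by move=> [muT _] [nuT _]; rewrite /mutual energyC. Qed.

Lemma mutualD mu nu eta : tame mu -> tame nu -> tame eta ->
  mutual (radonD mu nu) eta = mutual mu eta + mutual nu eta.
Proof.
move=> tmu tnu teta; rewrite /mutual energyD; last by case: teta.
by rewrite fineD//; exact: tame_energy_fin.
Qed.

Lemma mutualZ c mu eta : tame mu -> tame eta ->
  mutual (radonZ c mu) eta = c%:num * mutual mu eta.
Proof.
move=> tmu teta; rewrite /mutual energyZ; last by case: teta.
by rewrite fineM//; exact: tame_energy_fin.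
Qed.

Lemma mutual0 eta : mutual (@radon0 R n) eta = 0.
Proof. by rewrite /mutual /energy integral_measure_zero. Qed.

Lemma tame_sum (I : finType) (P : pred I) (mu : I -> radon R n) :
  (forall i, tame (mu i)) -> tame (\big[@radonD R n/radon0]_(i | P i) mu i).
Proof. by move=> tmu; apply: big_ind => //; [exact: tame0|exact: tameD]. Qed.

Lemma mutual_sum (I : finType) (P : pred I) (mu : I -> radon R n) eta :
  (forall i, tame (mu i)) -> tame eta ->
  mutual (\big[@radonD R n/radon0]_(i | P i) mu i) eta =
  \sum_(i | P i) mutual (mu i) eta.
Proof.
(* Additivity of [mutual] requires tame partial sums, so tameness is carried through the
   induction. *)
move=> tmu teta; suff [] : tame (\big[@radonD R n/radon0]_(i | P i) mu i) /\
  mutual (\big[@radonD R n/radon0]_(i | P i) mu i) eta =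
  \sum_(i | P i) mutual (mu i) eta by [].
apply: (big_ind2 (fun m r => tame m /\ mutual m eta = r)) => //.
- by split; [exact: tame0|exact: mutual0].
- by move=> m1 r1 m2 r2 [t1 <-] [t2 <-]; split; [exact: tameD|exact: mutualD].
Qed.

(** Each term of the energy series is a polynomial in moments, hence converges; it is dominated by
    the term of nu1 and nu2, whose series is finite. *)
Lemma cvg_energy_setwise X (F : set_system X) (m1 m2 : X -> radon R n)
    mu1 mu2 nu1 nu2 : UltraFilter F -> tame nu1 -> tame nu2 ->
  (\forall z \near F, dominated (m1 z) nu1) -> (\forall z \near F, dominated (m2 z) nu2) ->
  dominated mu1 nu1 -> dominated mu2 nu2 ->
  (forall B, measurable B -> m1 z B @[z --> F] --> mu1 B) ->
  (forall B, measurable B -> m2 z B @[z --> F] --> mu2 B) ->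
  energy (m1 z) (m2 z) @[z --> F] --> energy mu1 mu2.
Proof.
move=> FU tnu1 tnu2 d1 d2 dmu1 dmu2 l1 l2.
have FF := @ultra_proper _ _ FU.
have [nu1T _] := tnu1; have [nu2T _] := tnu2.
have dT nu mu : dominated mu nu -> (nu setT < +oo)%E -> (mu setT < +oo)%E.
  by move=> munu; apply: le_lt_trans; exact: munu.
rewrite (energyE alphan (dT _ _ dmu1 nu1T) (dT _ _ dmu2 nu2T)).
have moment_cvg (m : X -> radon R n) mu nu : (nu setT < +oo)%E ->
    (\forall z \near F, dominated (m z) nu) -> dominated mu nu ->
    (forall B, measurable B -> m z B @[z --> F] --> mu B) ->
    forall k w, moment alpha (m z) (k := k) w @[z --> F] --> moment alpha mu w.
  move=> nuT dm dmu lm k w; apply: (cvg_Rintegral_setwise FU nuT dm dmu lm).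
  exact: bounded_measurable_test.
have := @tanneryE R X F (fun z k => eterm alpha k (m1 z) (m2 z))
  (fun k => eterm alpha k mu1 mu2) (fun k => eterm alpha k nu1 nu2) FF.
have h1 : \forall z \near F, forall k, 0 <= eterm alpha k (m1 z) (m2 z) <= eterm alpha k nu1 nu2.
  near=> z => k.
  have dx1 : dominated (m1 z) nu1 by near: z.
  have dx2 : dominated (m2 z) nu2 by near: z.
  by rewrite eterm_ge0 ?eterm_le//; [exact: (dT _ _ dx1)|exact: (dT _ _ dx2)].
move=> /(_ h1); rewrite -(energyE alphan)// => /(_ _ _)H.
apply: cvg_trans; last apply: H.
- apply: near_eq_cvg; near=> z.
  have dx1 : dominated (m1 z) nu1 by near: z.
  have dx2 : dominated (m2 z) nu2 by near: z.
  by rewrite (energyE alphan (dT _ _ dx1 nu1T) (dT _ _ dx2 nu2T)).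
- by rewrite -ge0_fin_numE ?energy_ge0// tame_energy_fin.
move=> k; apply: cvgM; first exact: cvg_cst.
apply: (cvg_big _ (P := xpredT)); first exact: add_continuous.
move=> w _; apply: cvgM.
- exact: (moment_cvg _ _ nu1).
- exact: (moment_cvg _ _ nu2).
Unshelve. all: by end_near. Qed.

End tame_measures.

(** * Countable base, supports and comparison of distances *)

Section geometry.
Context {R : realType} {n : nat}.
Implicit Types (x y : 'rV[R]_n) (mu nu : radon R n).

(** Enumerates a countable base. The balls are those of the sup norm, hence products of intervals,
    which [mul_ball] exploits. *)
Definition rational_ball (k : nat) : set 'rV[R]_n :=
  match (unpickle k : option ('rV[rat]_n * nat)) with
  | Some (q, j) => ball (map_mx ratr q : 'rV[R]_n) j.+1%:R^-1
  | None => set0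
  end.

Lemma open_rational_ball k : open (rational_ball k).
Proof.
by rewrite /rational_ball; case: unpickle => [[q j]|]; [exact: ball_open|exact: open0].
Qed.

Lemma rational_ball_basis (U : set 'rV[R]_n) x : open U -> U x ->
  exists2 k, rational_ball k x & rational_ball k `<=` U.
Proof.
move=> oU Ux; have /nbhs_ballP[e /= e0 eU] := open_nbhs_nbhs (conj oU Ux).
have [j je] : exists j, j.+1%:R^-1 < e / 2 :> R.
  have e2 : 0 < e / 2 by rewrite divr_gt0.
  have [j _ /(_ j (leqnn j))] := near_infty_natSinv_lt (PosNum e2).
  by exists j.
have j0 : 0 < j.+1%:R^-1 :> R by rewrite invr_gt0.
have /choice[q qP] (i : 'I_n) : exists q : rat, ratr q \in `](x ord0 i - j.+1%:R^-1), (x ord0 i + j.+1%:R^-1)[.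
  by apply: rat_in_itvoo; rewrite ltrD2l gt0_cp.
pose Q : 'rV[rat]_n := \row_i q i.
have xQ : ball (map_mx ratr Q : 'rV[R]_n) j.+1%:R^-1 x.
  split=> // i k; rewrite !mxE /ball/= ord1 distrC.
  by have := qP k; rewrite in_itv/= -ltr_distlC distrC.
exists (pickle (Q, j)); rewrite /rational_ball pickleK// => y Qy; apply: eU.
rewrite (splitr e); apply: (ball_triangle (y := (map_mx ratr Q : 'rV[R]_n))).
  by apply: ball_sym; apply: (le_ball (ltW je)).
exact: (le_ball (ltW je)).
Qed.

(** Every point outside the support lies in a null rational ball, and there are countably many of
    these. *)
Lemma msupportC_null mu : mu (~` msupport mu) = 0%E.
Proof.
pose N k := if `[< mu (rational_ball k) = 0%E >] then rational_ball k else set0.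
have NE : ~` msupport mu = \bigcup_k N k.
  apply/seteqP; split => [x /= nx|x [k _ Nkx] /=].
    have [U [oU Ux] muU] : exists2 U, open_nbhs x U & mu U = 0%E.
      apply: contrapT => H; apply: nx => U xU; rewrite lt0e measure_ge0 andbT.
      by apply/eqP => U0; apply: H; exists U.
    have [k kx kU] := rational_ball_basis oU Ux; exists k => //.
    rewrite /N asboolT//; apply/eqP; rewrite eq_le measure_ge0 andbT -muU.
    by rewrite le_measure ?inE//; apply: measurable_open => //; exact: open_rational_ball.
  move: Nkx; rewrite /N; case: ifPn => // /asboolP k0 kx /(_ (rational_ball k)).
  rewrite k0 ltxx => /(_ _)H; suff : false by [].
  by apply: H; split => //; exact: open_rational_ball.
have oN k : open (N k).
  by rewrite /N; case: ifP => _; [exact: open_rational_ball|exact: open0].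
rewrite NE; apply/eqP; rewrite -measure_le0.
have [|A [mA A0 NA]] := @negligible_bigcup _ _ _ mu N.
  move=> k; exists (N k); split => //; first by apply: measurable_open.
  by rewrite /N; case: ifPn => [/asboolP//|_]; rewrite measure0.
rewrite -A0 le_measure ?inE//.
by apply: bigcup_measurable => k _; apply: measurable_open.
Qed.

Lemma continuous_sqnB x : continuous (fun y : 'rV[R]_n => sqn (x - y)).
Proof.
move=> y; apply: (cvg_big (F := nbhs y) _ (P := xpredT)); first exact: add_continuous.
move=> k _; under eq_fun do rewrite expr2 !mxE.
rewrite expr2 !mxE; apply: cvgM; apply: cvgB; try exact: cvg_cst.
- exact: (@coord_continuous _ _ _ ord0 k y).
- exact: (@coord_continuous _ _ _ ord0 k y).
Qed.


Lemma sqnN x : sqn (- x) = sqn x.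
Proof. by apply: eq_bigr => k _; rewrite mxE sqrrN. Qed.

Lemma compact_sqn_le (M : R) : compact [set y : 'rV[R]_n | sqn y <= M].
Proof.
pose s := Num.sqrt M.
have cbox : compact [set v : 'rV[R]_n | forall i, v ord0 i \in `[(- s), s]].
  apply: (@rV_compact _ _ (fun=> `[(- s), s]%classic)) => _.
  exact: segment_compact.
apply: (subclosed_compact _ cbox); last first.
  move=> y /= yM k; rewrite in_itv/= -ler_norml -sqrtr_sqr ler_wsqrtr// (le_trans _ yM)//.
  by rewrite /sqn (bigD1 k)//= lerDl sumr_ge0// => ? _; exact: sqr_ge0.
have := @closed_comp _ _ (fun y : 'rV[R]_n => sqn (0 - y)) [set r : R | r <= M] _ (@closed_le R M).
rewrite (_ : _ @^-1` _ = [set y | sqn y <= M]).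
  by apply => y _; exact: continuous_sqnB.
by apply/seteqP; split => y /=; rewrite sub0r sqnN.
Qed.

Lemma sqn_le4 x y z : sqn (x - z) <= sqn (z - y) -> sqn (x - y) <= 4 * sqn (z - y).
Proof.
move=> xz; suff : sqn (x - y) <= 2 * sqn (x - z) + 2 * sqn (z - y) by lra.
rewrite /sqn !mulr_sumr -big_split/=; apply: ler_sum => k _; rewrite !mxE.
have := sqr_ge0 ((x ord0 k - z ord0 k) - (z ord0 k - y ord0 k)); lra.
Qed.

(** From |x-y| <= 2 |z-y|; the constant is 4^b = 2^(n-alpha). If z = y, the hypothesis forces x =
    y. *)
Lemma riesz_le4 alpha x y z : alpha < n%:R -> sqn (x - z) <= sqn (z - y) ->
  (riesz alpha z y <= (4 `^ half_codim (n := n) alpha)%:E * riesz alpha x y)%E.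
Proof.
move=> alphan xz.
have [->|xy] := eqVneq x y.
  by rewrite [in leRHS]/riesz eqxx gt0_muley ?leey// lte_fin powR_gt0.
have [zy|zy] := eqVneq z y.
  move: xz; rewrite zy subrr (_ : sqn 0 = 0); last by apply/eqP; rewrite sqn_eq0.
  move=> H; have : sqn (x - y) == 0 by rewrite eq_le H sqn_ge0.
  by rewrite sqn_eq0 subr_eq0 (negbTE xy).
rewrite !riesz_sqn// -EFinM lee_fin.
have b0 := half_codim_gt0 alphan.
have zy0 : 0 < sqn (z - y) by rewrite lt_def sqn_eq0 subr_eq0 zy sqn_ge0.
have xy0 : 0 < sqn (x - y) by rewrite lt_def sqn_eq0 subr_eq0 xy sqn_ge0.
rewrite !powRN -ler_pdivrMl ?powR_gt0// -powRN.
rewrite -[leLHS]mulrC -lef_pV2 ?posrE ?mulr_gt0 ?invr_gt0 ?powR_gt0//.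
rewrite invrK invfM invrK powRN invrK mulrC -powRM ?(ltW zy0)//.
by rewrite ge0_ler_powR ?nnegrE ?(ltW b0) ?(ltW xy0) ?mulr_ge0 ?(ltW zy0)// sqn_le4.
Qed.

End geometry.

(** * Bounded potentials, integrable fields and sets of capacity zero *)

Section tame_criteria.
Context {R : realType} {n : nat}.
Variable alpha : R.
Hypothesis alphan : alpha < n%:R.
Implicit Types (x y z : 'rV[R]_n) (mu nu zeta : radon R n).
Let c4 : R := 4 `^ half_codim (n := n) alpha.

Lemma measurable_compact (K : set 'rV[R]_n) : compact K -> measurable K.
Proof.
by move=> cK; apply: measurable_closed; apply: compact_closed => //; exact: norm_hausdorff.
Qed.

Lemma potential_le4 mu (N : set 'rV[R]_n) x z : measurable N -> mu N = 0%E ->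
  (forall y, ~ N y -> sqn (x - z) <= sqn (z - y)) ->
  (potential alpha mu z <= c4%:E * potential alpha mu x)%E.
Proof.
move=> mN N0 xz; have c40 : 0 <= c4 by exact: powR_ge0.
have mr (t : 'rV[R]_n) : measurable_fun setT (riesz alpha t) by exact: (measurable_riesz alphan).
rewrite /potential -ge0_integralZl//; last by move=> y _; exact: riesz_ge0.
apply: ae_ge0_le_integral => //.
- by move=> y _; exact: riesz_ge0.
- by move=> y _; rewrite mule_ge0// ?riesz_ge0.
- exact: measurable_funeM.
exists N; split => // y /= H; apply: contrapT => Ny; apply: H => _.
by apply: riesz_le4 => //; exact: xz.
Qed.

Lemma finite_carried_compact mu (K : set 'rV[R]_n) : compact K ->
  mu (~` K) = 0%E -> (mu setT < +oo)%E.
Proof.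
move=> cK K0; have mK := measurable_compact cK.
rewrite -(setUv K) measureU ?setICr//; last exact: measurableC.
by rewrite [X in (_ + X < _)%E](_ : _ = 0%E) ?adde0 ?radon_compact.
Qed.

(** A weak maximum principle. If x is a point of K nearest to z, then |x-z| <= |z-y| for all y in K,
    so the potential at z is at most [c4] times that at x, which is bounded by continuity on the
    compact K. *)
Lemma tame_of_continuous mu (K : set 'rV[R]_n) : compact K -> K !=set0 ->
  mu (~` K) = 0%E -> (forall x, K x -> potential alpha mu x \is a fin_num) ->
  {within K, continuous (potential alpha mu)} -> tame alpha mu.
Proof.
move=> cK K0 muK Kfin Kcont; split; first exact: (finite_carried_compact cK).
have mK := measurable_compact cK.
have [|x0 _ x0max] := @compact_EVT_max _ R (fine \o potential alpha mu) K K0 cK.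
  apply/subspace_continuousP => x Kx.
  move/subspace_continuousP : Kcont => /(_ x Kx).
  by rewrite -[X in _ --> X](fineK (Kfin x Kx)) => /fine_cvgP[].
have boundK x : K x -> (potential alpha mu x <= (fine (potential alpha mu x0))%:E)%E.
  by move=> Kx; rewrite -(fineK (Kfin x Kx)) lee_fin; apply: x0max; rewrite inE.
exists (c4 * fine (potential alpha mu x0)) => z.
have [x Kx xmin] := compact_EVT_min K0 cK
  (continuous_subspaceT (@continuous_sqnB R n z)).
rewrite inE in Kx; rewrite EFinM; apply: le_trans (lee_wpmul2l _ (boundK _ Kx)); last first.
  by rewrite lee_fin powR_ge0.
apply: (potential_le4 (measurableC mK) muK) => y /contrapT Ky.
by rewrite -sqnN opprB; apply: xmin; rewrite inE.
Qed.

Lemma radonRestr_compact (D : set 'rV[R]_n) (mD : measurable D) mu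
    (K : set 'rV[R]_n) : compact K ->
  ((mrestr mu mD : {measure set 'rV[R]_n -> \bar R}) K < +oo)%E.
Proof.
move=> cK; have mK := measurable_compact cK.
rewrite /= /mrestr (le_lt_trans _ (radon_compact mu cK))// le_measure ?inE//.
exact: measurableI.
Qed.

Definition radonRestr D (mD : measurable D) mu : radon R n :=
  Radon (@radonRestr_compact D mD mu).

Lemma radonRestrE D (mD : measurable D) mu B : radonRestr mD mu B = mu (B `&` D).
Proof. by []. Qed.

Lemma radonRestr_dominated D (mD : measurable D) mu : dominated (radonRestr mD mu) mu.
Proof.
by move=> B mB; rewrite radonRestrE le_measure ?inE//; exact: measurableI.
Qed.

Lemma potential_split D (mD : measurable D) mu x : potential alpha mu x =
  (potential alpha (radonRestr mD mu) x +
   potential alpha (radonRestr (measurableC mD) mu) x)%E.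
Proof.
rewrite -(potentialD alphan); apply: eq_measure_integral => B mB _.
rewrite [RHS]measure_addE /= /mrestr -measureU; first by rewrite -setIUr setUv setIT.
- exact: measurableI.
- by apply: measurableI => //; exact: measurableC.
by rewrite setIACA setICr setI0.
Qed.

(** Shells cut a Radon measure of possibly infinite mass into countably many finite ones, to which
    [measurable_potential] applies. *)
Let shell k : set 'rV[R]_n := [set y | k%:R <= sqn y < k.+1%:R].

Let measurable_shell k : measurable (shell k).
Proof.
have := @measurable_sqn R n measurableT _ (measurable_itv `[(k%:R : R), k.+1%:R[).
by rewrite setTI; congr measurable; apply/seteqP; split => y /=; rewrite in_itv.
Qed.

Lemma measurable_potential_radon mu : measurable_fun setT (potential alpha mu).
Proof.
pose m k := radonRestr (measurable_shell k) mu.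
have mfin k : (m k setT < +oo)%E.
  rewrite /m radonRestrE setTI (le_lt_trans _ (radon_compact mu (@compact_sqn_le R n k.+1%:R)))//.
  rewrite le_measure ?inE//; first by apply: measurable_compact; exact: compact_sqn_le.
  by move=> y /= /andP[_ /ltW].
have E x : potential alpha mu x = (\sum_(0 <= k <oo) potential alpha (m k) x)%E.
  rewrite -ge0_integral_measure_series//; last exact: (measurable_riesz alphan).
    apply: eq_measure_integral => B mB _.
    have EB : B = \bigcup_k (B `&` shell k).
      apply/seteqP; split => y; last by move=> [k _ []].
      move=> By; exists (Num.truncn (sqn y)) => //; split => //=.
      exact: (truncn_itv (sqn_ge0 y)).
    have lt_disj y i j : (i < j)%N -> shell i y -> shell j y -> False.
      rewrite -(ler_nat R) => ij /andP[_ y1] /andP[y2 _].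
      by have := lt_le_trans y1 (le_trans ij y2); rewrite ltxx.
    rewrite [LHS](_ : mu B = \sum_(0 <= k <oo) mu (B `&` shell k))%E//.
    rewrite [in LHS]EB measure_semi_bigcup//.
    - by move=> k; exact: measurableI.
    - apply/trivIsetP => i j _ _; rewrite neq_ltn => ij; apply/seteqP; split => // y /= [[_ yi] [_ yj]].
      by case/orP: ij => ij; [exact: (lt_disj y i j)|exact: (lt_disj y j i)].
    - by apply: bigcup_measurable => k _; exact: measurableI.
  by move=> y _; exact: riesz_ge0.
rewrite (funext E); apply: ge0_emeasurable_sum => [k x _ _|k _].
  exact: potential_ge0.
exact: measurable_potential.
Qed.

(* A measure of finite energy has a finite potential somewhere, which controls
   the far part of the potential on compact sets; the near part is the mutual
   energy with a finite measure. *)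
Lemma finite_energy_potential_integral zeta mu (K : set 'rV[R]_n) :
  tame alpha mu -> compact K -> mu (~` K) = 0%E ->
  (energy alpha zeta zeta < +oo)%E -> (\int[mu]_x potential alpha zeta x < +oo)%E.
Proof.
move=> tmu cK muK zfin; have [muT [C Cmu]] := tmu.
have mK := measurable_compact cK.
(* Otherwise the potential is +oo everywhere and a nonzero measure would have infinite energy. *)
have [x0 x0fin] : exists x0, (potential alpha zeta x0 < +oo)%E \/ zeta setT = 0%E.
  have [z0|z0] := eqVneq (zeta setT) 0%E; first by exists 0; right.
  apply: contrapT => H; move: zfin; rewrite /energy.
  under eq_integral => x _.
    rewrite (_ : potential alpha zeta x = +oo%E); last first.
      by apply/eqP; rewrite -leye_eq leNgt; apply/negP => xfin; apply: H; exists x; left.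
    over.
  by rewrite integral_cst// gt0_mulye// lt0e z0 /=.
have {}x0fin : (potential alpha zeta x0 < +oo)%E.
  case: x0fin => // z0; rewrite /potential.
  by rewrite null_set_integral//; exact: (measurable_riesz alphan).
have [K0|/set0P Kn] := eqVneq K set0.
  move: muK; rewrite K0 setC0 => mu0.
  by rewrite null_set_integral//; exact: measurable_potential_radon.
have [x1 _ x1max] := compact_EVT_max Kn cK (continuous_subspaceT (@continuous_sqnB R n 0)).
have [x2 _ x2max] := compact_EVT_max Kn cK (continuous_subspaceT (@continuous_sqnB R n x0)).
(* Since |y|^2 <= 2 |x|^2 + 2 |x-y|^2, the condition |y|^2 > M forces |x0-x| <= |x-y| for all x in
   K, as [potential_le4] requires. *)
pose M := 2 * sqn (0 - x1) + 2 * sqn (x0 - x2).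
pose D := [set y : 'rV[R]_n | sqn y <= M].
have cD : compact D by exact: compact_sqn_le.
have mD := measurable_compact cD.
pose near_ := radonRestr mD zeta; pose far := radonRestr (measurableC mD) zeta.
have near_fin : (near_ setT < +oo)%E by rewrite /near_ radonRestrE setTI radon_compact.
have far_le x : K x -> (potential alpha far x <= c4%:E * potential alpha zeta x0)%E.
  move=> Kx; apply: (@le_trans _ _ (c4%:E * potential alpha far x0)%E); last first.
    rewrite lee_wpmul2l ?lee_fin ?powR_ge0//; apply: potential_le => //.
    exact: radonRestr_dominated.
  apply: (@potential_le4 _ D) => //.
    by rewrite /far radonRestrE setICr measure0.
  move=> y /negP; rewrite -ltNge => Dy.
  have := x2max x; have := x1max x; rewrite inE => /(_ Kx) h1 /(_ Kx) h2.
  apply: (le_trans h2); suff : sqn y <= 2 * sqn (0 - x) + 2 * sqn (x - y).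
    by move: Dy; rewrite /M; lra.
  rewrite /sqn !mulr_sumr -big_split/=; apply: ler_sum => k _; rewrite !mxE.
  by have := sqr_ge0 (x ord0 k + (x ord0 k - y ord0 k)); lra.
apply: (@le_lt_trans _ _ (\int[mu]_x (potential alpha near_ x + c4%:E * potential alpha zeta x0))%E).
  apply: ae_ge0_le_integral => //.
  - by move=> x _; exact: potential_ge0.
  - exact: measurable_potential_radon.
  - by move=> x _; rewrite adde_ge0 ?mule_ge0 ?potential_ge0// lee_fin powR_ge0.
  - by apply: emeasurable_funD => //; exact: measurable_potential_radon.
  exists (~` K); split => //; first exact: measurableC.
  move=> x /= H Kx; apply: H => _.
  by rewrite (potential_split mD) leeD2l// far_le.
rewrite ge0_integralD//; last 3 first.
- by move=> x _; exact: potential_ge0.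
- exact: measurable_potential_radon.
- by move=> x _; rewrite mule_ge0 ?potential_ge0// lee_fin powR_ge0.
rewrite integral_cst// lte_add_pinfty//; last first.
  by rewrite !lte_mul_pinfty ?mule_ge0 ?potential_ge0 ?lee_fin ?powR_ge0// fin_numM// ge0_fin_numE ?potential_ge0.
(* By symmetry the bounded potential of mu is integrated against the finite measure [near_]. *)
rewrite -/(energy alpha mu near_) energyC//.
apply: (@le_lt_trans _ _ (\int[near_]_x C%:E)%E).
  apply: ge0_le_integral => //.
  - by move=> x _; exact: potential_ge0.
  - exact: measurable_potential_radon.
rewrite integral_cst//.
by rewrite lte_mul_pinfty// (le_trans _ (Cmu 0))// potential_ge0.
Qed.

(** If mu charged Q, its normalised restriction to Q would compete in the capacity with finite
    energy, and the infimum would not be +oo. *)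
Lemma capacity0_null mu (Q : set 'rV[R]_n) : tame alpha mu -> measurable Q ->
  capacity alpha Q = 0%E -> mu Q = 0%E.
Proof.
move=> tmu mQ cQ; apply/eqP/negPn/negP => muQ.
have [muT _] := tmu.
have muQfin : mu Q \is a fin_num.
  by rewrite ge0_fin_numE// (le_lt_trans _ muT)// le_measure ?inE.
have muQ0 : 0 < fine (mu Q) by rewrite fine_gt0// lt0e muQ measure_ge0/= -ge0_fin_numE.
have c0 : 0 <= (fine (mu Q))^-1 by rewrite invr_ge0 ltW.
pose c : {nonneg R} := NngNum c0.
pose nu := radonZ c (radonRestr mQ mu).
have tnu : tame alpha nu.
  by apply: tameZ => //; apply: (tame_dominated alphan) tmu => //; exact: radonRestr_dominated.
have nuin : [set energy alpha nu' nu' | nu' in [set nu' : radon R n |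
    [/\ energy alpha nu' nu' < +oo, nu' (~` Q) = 0 & nu' Q = 1]%E]] (energy alpha nu nu).
  exists nu => //; split.
  - by rewrite -ge0_fin_numE ?energy_ge0// tame_energy_fin.
  - by rewrite /= /mscale/= /mrestr setICl measure0 mule0.
  - by rewrite /= /mscale/= /mrestr setIid -(fineK muQfin) -EFinM mulVf// gt_eqF.
move: cQ; rewrite /capacity => /eqP; rewrite inve_eq0 => /eqP infy.
have := ge_ereal_inf (ex_intro2 _ _ _ nuin (lexx _)); rewrite infy leye_eq => /eqP nuy.
by have := tame_energy_fin alphan tnu tnu; rewrite nuy.
Qed.

End tame_criteria.

(** * Strict definiteness of the energy *)

Lemma cvg_norm_le (R : realType) (u : R^nat) (l C : R) :
  u k @[k --> \oo] --> l -> (forall k, `|u k| <= C) -> `|l| <= C.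
Proof.
move=> ul uC; have c : `|u k| @[k --> \oo] --> `|l| by exact: cvg_norm.
rewrite -(cvg_lim _ c)//; apply: limr_le; first exact: cvgP c.
exact: nearW.
Qed.

(** * The algebra of functions preserving annihilators *)

Section multiplier_algebra.
Context {d} {T : measurableType d} {R : realType} {J : finType} {W : Type}.
Variables (eps : J -> R) (m : J -> {measure set T -> \bar R}) (tst : W -> T -> R).
Hypothesis m_fin : forall j, (m j setT < +oo)%E.
Hypothesis tst_bounded : forall w, bounded_measurable (tst w).
Implicit Types h g : T -> R.

Definition signed_integral h : R := \sum_j eps j * \int[m j]_x h x.
Local Notation L := signed_integral.

Lemma signed_integralD h g : bounded_measurable h -> bounded_measurable g ->
  L (fun x => h x + g x) = L h + L g.
Proof.
move=> bh bg; rewrite -big_split/=; apply: eq_bigr => j _; rewrite -mulrDr; congr (_ * _).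
by apply: RintegralD => //; exact: bounded_measurable_integrable.
Qed.

Lemma signed_integralZ (c : R) h : bounded_measurable h ->
  L (fun x => c * h x) = c * L h.
Proof.
move=> bh; rewrite /L mulr_sumr; apply: eq_bigr => j _; rewrite mulrCA; congr (_ * _).
by apply: RintegralZl => //; exact: bounded_measurable_integrable.
Qed.

Lemma signed_integral_lim (h_ : nat -> T -> R) h (C : R) :
  (forall k, measurable_fun setT (h_ k)) -> (forall k x, `|h_ k x| <= C) ->
  (forall x, h_ k x @[k --> \oo] --> h x) ->
  L (h_ k) @[k --> \oo] --> L h.
Proof.
move=> mh hC hh; apply: (cvg_big _ (P := xpredT)); first exact: add_continuous.
move=> j _; apply: cvgM; first exact: cvg_cst.
have mh' : measurable_fun setT h by apply: (measurable_fun_cvg mh) => x _; exact: hh.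
have hC' x : `|h x| <= C.
  exact: (cvg_norm_le (hh x)).
have bh : bounded_measurable h by split => //; exists C.
apply: fine_cvg; rewrite fineK; last first.
  exact: (integrable_fin_num _ (bounded_measurable_integrable (m_fin j) bh)).
apply: (@dominated_cvg _ _ _ (m j) setT measurableT _ _ (fun=> C%:E)) => //.
- by move=> k; apply/measurable_EFinP.
- by move=> x _; apply: cvg_EFin; [exact: nearW|exact: hh].
- exact: (bounded_measurable_integrable (m_fin j) (bounded_measurable_cst C)).
- by move=> k x _; rewrite /= lee_fin.
Qed.

Definition annihilator g := bounded_measurable g /\ forall w, L (fun x => g x * tst w x) = 0.

(** Closed under products by construction, whatever the test functions are, and under bounded
    pointwise limits by dominated convergence; this takes the place of density of the tests. *)
Definition multiplier h := bounded_measurable h /\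
  forall g, annihilator g -> annihilator (fun x => g x * h x).

Lemma multiplier_cst c : multiplier (fun=> c).
Proof.
split; first exact: bounded_measurable_cst.
move=> g [bg g0]; split; first by apply: bounded_measurableM => //; exact: bounded_measurable_cst.
move=> w; rewrite (_ : (fun _ => _) = (fun x => c * (g x * tst w x))); last first.
  by apply/funext => x; ring.
by rewrite signed_integralZ ?g0 ?mulr0//; exact: bounded_measurableM.
Qed.

Lemma multiplierD h1 h2 : multiplier h1 -> multiplier h2 ->
  multiplier (fun x => h1 x + h2 x).
Proof.
move=> [b1 m1] [b2 m2]; split; first exact: bounded_measurableD.
move=> g ag; have [bg _] := ag; have [b1' g1] := m1 g ag; have [b2' g2] := m2 g ag.
split; first by apply: bounded_measurableM => //; exact: bounded_measurableD.
move=> w; rewrite (_ : (fun _ => _) = (fun x => g x * h1 x * tst w x + g x * h2 x * tst w x)).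
  by rewrite signed_integralD ?g1 ?g2 ?addr0//; exact: bounded_measurableM.
by apply/funext => x; ring.
Qed.

Lemma multiplierM h1 h2 : multiplier h1 -> multiplier h2 ->
  multiplier (fun x => h1 x * h2 x).
Proof.
move=> [b1 m1] [b2 m2]; split; first exact: bounded_measurableM.
move=> g ag; rewrite (_ : (fun _ => _) = (fun x => (g x * h1 x) * h2 x)).
  exact/m2/m1.
by apply/funext => x; rewrite mulrA.
Qed.

Lemma multiplierZ c h : multiplier h -> multiplier (fun x => c * h x).
Proof. by move=> mh; apply: multiplierM => //; exact: multiplier_cst. Qed.

Lemma multiplierB h1 h2 : multiplier h1 -> multiplier h2 ->
  multiplier (fun x => h1 x - h2 x).
Proof.
move=> mh1 mh2; under eq_fun do rewrite -mulN1r.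
by apply: multiplierD => //; exact: multiplierZ.
Qed.

Lemma multiplierX h k : multiplier h -> multiplier (fun x => h x ^+ k).
Proof.
move=> mh; elim: k => [|k IH]; first exact: multiplier_cst.
by under eq_fun do rewrite exprS; exact: multiplierM.
Qed.

Lemma multiplier_lim (h_ : nat -> T -> R) h C :
  (forall k, multiplier (h_ k)) -> (forall k x, `|h_ k x| <= C) ->
  (forall x, h_ k x @[k --> \oo] --> h x) -> multiplier h.
Proof.
move=> mh hC hh.
have mf : measurable_fun setT h.
  apply: (@measurable_fun_cvg _ _ _ _ h_) => [k|x _]; last exact: hh.
  by have [[]] := mh k.
have bh : bounded_measurable h.
  by split=> //; exists C => x; exact: (cvg_norm_le (hh x)).
split => // g ag; have [bg _] := ag; split; first exact: bounded_measurableM.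
move=> w; have [bw1 [D wD]] := tst_bounded w; have [bg1 [E gE]] := bg.
have := @signed_integral_lim (fun k x => g x * h_ k x * tst w x)
  (fun x => g x * h x * tst w x) (E * C * D).
have H1 k : measurable_fun setT (fun x => g x * h_ k x * tst w x).
  by have [[+ _] _] := mh k => ?; apply: measurable_funM => //; exact: measurable_funM.
have H2 k x : `|g x * h_ k x * tst w x| <= E * C * D.
  by rewrite !normrM ler_pM ?mulr_ge0// ler_pM.
have H3 x : g x * h_ k x * tst w x @[k --> \oo] --> g x * h x * tst w x.
  by apply: cvgM; [apply: cvgM; [exact: cvg_cst|exact: hh]|exact: cvg_cst].
move=> /(_ H1 H2 H3) c; rewrite -(cvg_lim _ c)//.
under eq_fun => k.
  rewrite (_ : L _ = 0); last by have [_ /(_ _ ag)[_]] := mh k.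
  over.
by rewrite lim_cst.
Qed.

(* By Bernoulli's inequality [1 - k (2 s)^k <= (1 - s^k)^(k 2^k)] and
   [(1 - s^k)^(k 2^k) <= 1 / (1 + k (2 s)^k)], so the powers below converge to
   the indicator of [s < 1/2]. *)
Lemma cvg_threshold (s : R) : 0 <= s <= 1 ->
  (1 - s ^+ k) ^+ (k * 2 ^ k) @[k --> \oo] --> ((s < 2^-1)%R%:R : R).
Proof.
move=> /andP[s0 s1].
have sk0 k : 0 <= s ^+ k by exact: exprn_ge0.
have sk1 k : s ^+ k <= 1 by exact: exprn_ile1.
have bernoulli (t : R) k : -1 <= t -> 1 + k%:R * t <= (1 + t) ^+ k.
  move=> t1; elim: k => [|k IH]; first by rewrite mul0r addr0 expr0.
  have t10 : 0 <= 1 + t by lra.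
  have := ler_wpM2l t10 IH; rewrite exprS -natr1; apply: le_trans.
  have : 0 <= k%:R * (t * t) by rewrite mulr_ge0// -expr2 sqr_ge0.
  lra.
have E k : (k * 2 ^ k)%:R * s ^+ k = k%:R * (2 * s) ^+ k.
  by rewrite natrM natrX exprMn mulrA.
have [s2|s2] := ltP s 2^-1.
  pose r := Num.sqrt (2 * s).
  have r0 : 0 <= r by exact: sqrtr_ge0.
  have rE : r ^+ 2 = 2 * s by rewrite sqr_sqrtr// mulr_ge0.
  have r1 : r < 1 by rewrite -(@ltr_pXn2r _ 2)// ?nnegrE// expr1n rE; lra.
  have cr : (1 - r) ^-1 * r ^+ k @[k --> \oo] --> 0.
    rewrite -(mulr0 (1 - r)^-1); apply: cvgM; first exact: cvg_cst.
    by apply: cvg_expr; rewrite ger0_norm.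
  apply: (@squeeze_cvgr _ _ _ _ (fun k => 1 - (1 - r)^-1 * r ^+ k) (cst 1)).
  - apply: nearW => k; apply/andP; split; last first.
      by rewrite exprn_ile1 ?subr_ge0 ?gerBl.
    apply: le_trans (bernoulli (- s ^+ k) (k * 2 ^ k)%N _); last by rewrite lerN2.
    rewrite mulrN lerD2l lerN2 E -rE -exprM mul2n -addnn exprD mulrA.
    by rewrite ler_wpM2r ?exprn_ge0// natr_expr_le// r0.
  - by rewrite -[X in _ --> X]subr0; apply: cvgB => //; exact: cvg_cst.
  - exact: cvg_cst.
apply: (@squeeze_cvgr _ _ _ _ (cst 0) (fun k => k.+1%:R^-1)).
- apply: nearW => k; apply/andP; split; first by rewrite exprn_ge0// subr_ge0.
  have K : (1 - s ^+ k) ^+ (k * 2 ^ k) * (1 + s ^+ k) ^+ (k * 2 ^ k) <= 1.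
    rewrite -exprMn exprn_ile1//; first by rewrite mulr_ge0 ?subr_ge0 ?addr_ge0.
    have := sqr_ge0 (s ^+ k); lra.
  have K2 : k.+1%:R <= (1 + s ^+ k) ^+ (k * 2 ^ k).
    apply: le_trans (bernoulli _ _ _); last by rewrite (le_trans _ (sk0 k)).
    rewrite E -natr1 addrC lerD2l ler_peMr// exprn_ege1//; lra.
  have K0 : 0 <= (1 - s ^+ k) ^+ (k * 2 ^ k) by rewrite exprn_ge0// subr_ge0.
  rewrite -[leRHS]mul1r ler_pdivlMr//; apply: le_trans K.
  exact: ler_wpM2l.
- exact: cvg_cst.
- exact: cvg_harmonic.
Qed.

(** An affine map sends h into [0,1] so that h < 0 exactly where the image is below 1/2; the powers
    in [cvg_threshold] are polynomials in this image. *)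
Lemma multiplier_lt0 h : multiplier h -> multiplier (fun x => (h x < 0)%R%:R).
Proof.
move=> mh; have [[_ [C hC]] _] := mh.
pose D : R := `|C| + 1; have D0 : 0 < D by rewrite ltr_wpDl.
pose s x := 2^-1 + (2 * D)^-1 * h x.
have hD x : `|h x| <= D by rewrite (le_trans (hC x))// (le_trans (ler_norm C))// lerDl.
have s01 x : 0 <= s x <= 1.
  have := hD x; rewrite ler_norml => /andP[h1 h2].
  have D20 : 0 < (2 * D)^-1 by rewrite invr_gt0 mulr_gt0.
  have D2 : (2 * D)^-1 * D = 2^-1 by field; rewrite gt_eqF.
  have := ler_wpM2l (ltW D20) h1; have := ler_wpM2l (ltW D20) h2.
  by rewrite mulrN D2 /s; lra.
have sE x : (h x < 0) = (s x < 2^-1).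
  by rewrite /s gtrDl pmulr_rlt0// invr_gt0 mulr_gt0.
have ms : multiplier s.
  by apply: multiplierD; [exact: multiplier_cst|exact: multiplierZ].
under eq_fun do rewrite sE.
apply: (@multiplier_lim (fun k x => (1 - s x ^+ k) ^+ (k * 2 ^ k)) _ 1).
- move=> k; apply: multiplierX; apply: multiplierB; first exact: multiplier_cst.
  exact: multiplierX.
- move=> k x; have /andP[s0 s1] := s01 x.
  have sk0 : 0 <= s x ^+ k by exact: exprn_ge0.
  have sk1 : s x ^+ k <= 1 by exact: exprn_ile1.
  by rewrite ger0_norm ?exprn_ge0 ?subr_ge0// exprn_ile1 ?subr_ge0 ?gerBl.
- by move=> x; exact: cvg_threshold.
Qed.

Definition multiplier_set (B : set T) := multiplier (\1_B : T -> R).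

(** A complement has indicator 1 - h; a countable union is the bounded limit of 1 minus finite
    products of indicators of complements. *)
Lemma sigma_algebra_multiplier : sigma_algebra setT multiplier_set.
Proof.
split.
- rewrite /multiplier_set (_ : \1_set0 = (fun=> 0)); first exact: multiplier_cst.
  by apply/funext => x; rewrite indicE in_set0.
- move=> B mB; rewrite setTD /multiplier_set.
  rewrite (_ : \1_(~` B) = (fun x => 1 - \1_B x)).
    by apply: multiplierB => //; exact: multiplier_cst.
  by apply/funext => x; rewrite !indicE in_setC; case: (x \in B); rewrite ?subrr ?subr0.
- move=> B mB; rewrite /multiplier_set.
  pose h_ k x : R := 1 - \prod_(i < k) (1 - \1_(B i) x).
  have prodE k x : \prod_(i < k) (1 - \1_(B i) x : R) = (x \notin \bigcup_(i in `I_k) B i)%:R.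
    elim: k => [|k IH].
      by rewrite big_ord0 II0 bigcup_set0 in_set0.
    rewrite big_ord_recr/= IH indicE.
    rewrite IIS bigcup_setU bigcup_set1 in_setU.
    by case: (x \in _) => /=; case: (x \in _); rewrite /= ?subrr ?subr0 ?mulr0 ?mul0r ?mulr1.
  apply: (@multiplier_lim h_ _ 1).
  - move=> k; apply: multiplierB; first exact: multiplier_cst.
    elim: k => [|k IH].
      by under eq_fun do rewrite big_ord0; exact: multiplier_cst.
    under eq_fun do rewrite big_ord_recr/=; apply: multiplierM => //.
    by apply: multiplierB; [exact: multiplier_cst|exact: mB].
  - move=> k x; rewrite /h_ prodE; case: (x \notin _); rewrite ?subrr ?normr0// subr0 normr1.
    by [].
  - move=> x; rewrite indicE; apply: cvg_near_cst; rewrite /h_.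
    have [|xB] := boolP (x \in \bigcup_i B i).
      rewrite inE => -[i _ Bix]; exists i.+1 => // k /= ik; rewrite prodE.
      rewrite (_ : x \in _ = true) ?subr0//; apply/mem_set; exists i => //.
    apply: nearW => k; rewrite prodE (_ : x \in _ = false) ?subrr//.
    apply/negbTE; apply: contra xB; rewrite !inE => -[i _ Bix]; by exists i.
Qed.

End multiplier_algebra.

(** * Moments determine a compactly carried signed measure *)

Section energy_principle.
Context {R : realType} {n : nat} {J : finType}.
Variables (alpha : R) (eps : J -> R) (m : J -> radon R n) (K : set 'rV[R]_n).
Hypothesis alphan : alpha < n%:R.
Hypothesis tame_m : forall j, tame alpha (m j).
Hypothesis compactK : compact K.
Hypothesis m_K : forall j, m j (~` K) = 0%E.
Implicit Types (x y : 'rV[R]_n).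
Let b := half_codim (n := n) alpha.

Let word := {k : nat & {ffun 'I_k -> bool + 'I_n}}.
Let tst (w : word) : 'rV[R]_n -> R := test alpha (tagged w).
Let m_fin j : (m j setT < +oo)%E. Proof. by case: (tame_m j). Qed.
Let tst_bounded (w : word) : bounded_measurable (tst w).
Proof. exact: bounded_measurable_test. Qed.
Local Notation L := (signed_integral eps m).
Local Notation multiplier := (multiplier eps m tst).

(** Multiplying a test function by a feature prepends a letter to its word, so the family of tests
    is mapped into itself. *)
Let mul_feature j : multiplier (feature j).
Proof.
have bf : bounded_measurable (@feature R n j).
  by split; [exact: measurable_feature|exists 1 => x; exact: feature_le1].
split => // g [bg g0]; split; first exact: bounded_measurableM.
move=> [k w]; pose w' : {ffun 'I_k.+1 -> bool + 'I_n} :=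
  [ffun i => if unlift ord0 i is Some i' then w i' else j].
rewrite -[RHS](g0 (existT _ k.+1 w')); congr signed_integral; apply/funext => x.
rewrite /tst /test /= /monomial big_ord_recl ffunE unlift_none.
rewrite [in RHS](eq_bigr (fun i => feature (w i) x)); first by ring.
by move=> i _; rewrite ffunE liftK.
Qed.

(** Both features carry the positive factor 1/(1+|x|^2), so the combination has the sign of x_k -
    c. *)
Let mul_coord_lt k c : multiplier (fun x => (x ord0 k < c)%R%:R).
Proof.
have := @multiplier_lt0 _ _ _ _ _ eps m tst m_fin tst_bounded
  (fun x => feature (inr k) x - (Num.sqrt 2 * c) * feature (inl true) x).
have s2 : 0 < Num.sqrt 2 :> R by rewrite sqrtr_gt0.
rewrite (_ : (fun x => _%:R) = (fun x => (x ord0 k < c)%R%:R)); last first.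
  apply/funext => x; congr (_%:R); rewrite /= mul1r -mulrBl -mulrBr.
  by rewrite pmulr_llt0 ?invr_gt0 ?sqn1_gt0// pmulr_rlt0// subr_lt0.
apply; apply: multiplierB => //; apply: multiplierZ => //; exact: mul_feature.
Qed.

Let mul_coord_gt k c : multiplier (fun x => (c < x ord0 k)%R%:R).
Proof.
have := @multiplier_lt0 _ _ _ _ _ eps m tst m_fin tst_bounded
  (fun x => (Num.sqrt 2 * c) * feature (inl true) x - feature (inr k) x).
have s2 : 0 < Num.sqrt 2 :> R by rewrite sqrtr_gt0.
rewrite (_ : (fun x => _%:R) = (fun x => (c < x ord0 k)%R%:R)); last first.
  apply/funext => x; congr (_%:R); rewrite /= mul1r -mulrBl -mulrBr.
  by rewrite pmulr_llt0 ?invr_gt0 ?sqn1_gt0// pmulr_rlt0// subr_lt0.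
by apply; apply: multiplierB => //; apply: multiplierZ.
Qed.

Let mul_prod (s : seq 'I_n) (h : 'I_n -> 'rV[R]_n -> R) :
  (forall k, multiplier (h k)) -> multiplier (fun x => \prod_(k <- s) h k x).
Proof.
move=> mh; elim: s => [|k s IH].
  rewrite (_ : (fun x => _) = fun=> 1); first exact: multiplier_cst.
  by apply/funext => x; rewrite big_nil.
rewrite (_ : (fun x => _) = fun x => h k x * \prod_(i <- s) h i x); first exact: multiplierM.
by apply/funext => x; rewrite big_cons.
Qed.

Let mul_ball (q : 'rV[R]_n) (r : R) : 0 < r -> multiplier_set eps m tst (ball q r).
Proof.
move=> r0; rewrite /multiplier_set (_ : \1_(ball q r) =
  (fun x => \prod_(k <- index_enum 'I_n)
    ((x ord0 k < q ord0 k + r)%R%:R * (q ord0 k - r < x ord0 k)%R%:R))).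
  by apply: mul_prod => k; apply: multiplierM.
apply/funext => x; rewrite indicE.
have E k : (ball (q ord0 k) r (x ord0 k)) <->
    (x ord0 k < q ord0 k + r) && (q ord0 k - r < x ord0 k).
  by rewrite /ball/= ltr_distlC andbC.
have [xq|xq] := boolP (x \in (ball q r : set 'rV[R]_n)).
  rewrite big1// => k _; move: xq; rewrite inE => -[_ /(_ ord0 k)/E/andP[-> ->]].
  by rewrite mulr1.
have [k xk] : exists k, ~~ ((x ord0 k < q ord0 k + r) && (q ord0 k - r < x ord0 k)).
  apply: contrapT => H; move/negP: xq; apply; rewrite inE; split => // i k.
  by rewrite (ord1 i); apply/E; apply: contrapT => /negP xk; apply: H; exists k.
rewrite (bigD1 k)//= -natrM mulnb (negbTE xk) mul0r.
by [].
Qed.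

Let mul_measurable (B : set 'rV[R]_n) : measurable B -> multiplier_set eps m tst B.
Proof.
apply: smallest_sub; first exact: sigma_algebra_multiplier.
move=> U oU; pose V k := if `[< @rational_ball R n k `<=` U >] then @rational_ball R n k else set0.
have -> : U = \bigcup_k V k.
  apply/seteqP; split => [x Ux|x [k _]].
    have [k kx kU] := rational_ball_basis oU Ux; exists k => //.
    by rewrite /V asboolT.
  by rewrite /V; case: ifPn => // /asboolP; exact.
have [m0 _ mU] := @sigma_algebra_multiplier _ _ _ _ _ eps m tst m_fin tst_bounded.
apply: mU => k; rewrite /V; case: ifP => _ //.
rewrite /rational_ball; case: unpickle => [[q j]|] //.
by apply: mul_ball; rewrite invr_gt0.
Qed.

Hypothesis moments0 : forall k (w : {ffun 'I_k -> bool + 'I_n}),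
  \sum_j eps j * moment alpha (m j) w = 0.

Let mul_binpoly k h : multiplier h -> multiplier (fun x => (binpoly b k).[h x]).
Proof.
move=> mh; rewrite (_ : (fun x => _) = fun x => \sum_(i < k.+1) bincoef b i * h x ^+ i).
  elim: (k.+1) => [|l IH].
    rewrite (_ : (fun x => _) = fun=> 0); first exact: multiplier_cst.
    by apply/funext => x; rewrite big_ord0.
  rewrite (_ : (fun x => _) =
    fun x => \sum_(i < l) bincoef b i * h x ^+ i + bincoef b l * h x ^+ l).
    by apply: multiplierD => //; apply: multiplierZ => //; exact: multiplierX.
  by apply/funext => x; rewrite big_ord_recr.
by apply/funext => x; rewrite binpolyE.
Qed.

(** The constant 1 is an annihilator by hypothesis, and the test of the empty word is [weight]. A
    multiplier equal to the inverse weight on D and 0 elsewhere then isolates the integral of the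
    indicator of D; it is bounded because K is compact. *)
Lemma moments_determine (B : set 'rV[R]_n) : measurable B ->
  \sum_j eps j * fine (m j B) = 0.
Proof.
move=> mB; have mK := measurable_compact compactK.
have b0 : 0 < b := half_codim_gt0 alphan.
pose D := B `&` K; have mD : measurable D by exact: measurableI.
pose v0 x : R := (1 + sqn x)^-1.
have v0E x : v0 x = feature (inl true) x by rewrite /= mul1r.
have v0_gt0 x : 0 < v0 x by rewrite invr_gt0 sqn1_gt0.
have v0_le1 x : v0 x <= 1 by rewrite invf_le1 ?sqn1_gt0// lerDl sqn_ge0.
have v01 x : 0 <= 1 - v0 x < 1 by rewrite subr_ge0 v0_le1 gtrBl v0_gt0.
have [M KM] : exists M, forall x, K x -> (1 + sqn x) `^ b <= M.
  have [K0|/set0P Kn] := eqVneq K set0; first by exists 0 => x; rewrite K0.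
  have [x1 _ x1max] := compact_EVT_max Kn compactK (continuous_subspaceT (@continuous_sqnB R n 0)).
  exists ((1 + sqn x1) `^ b) => x Kx.
  rewrite ge0_ler_powR ?nnegrE ?(ltW b0) ?(ltW (sqn1_gt0 _))// lerD2l.
  by have := x1max x; rewrite !sub0r !sqnN inE; exact.
(* The inverse weight is v0^(-b), again a binomial series, now in 1 - v0. *)
pose h x : R := \1_D x * (v0 x) `^ (- b).
have mh : multiplier h.
  apply: (@multiplier_lim _ _ _ _ _ eps m tst m_fin tst_bounded
     (fun k x => \1_D x * (binpoly b k).[1 - v0 x]) _ `|M|).
  - move=> k; apply: multiplierM; first exact: mul_measurable.
    apply: mul_binpoly; apply: multiplierB => //; first exact: multiplier_cst.
    by rewrite (funext v0E); exact: mul_feature.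
  - move=> k x; rewrite indicE; have [|] := boolP (x \in D); last by rewrite mul0r normr0.
    rewrite inE mul1r => -[_ Kx]; rewrite ger0_norm.
      rewrite (le_trans (binpoly_le k b0 (v01 x)))// subKr (le_trans _ (ler_norm M))//.
      rewrite (le_trans _ (KM x Kx))// /v0 -powR_inv1 ?(ltW (sqn1_gt0 _))//.
      by rewrite -powRrM mulrNN mul1r.
    rewrite binpolyE; apply: sumr_ge0 => i _; have /andP[? _] := v01 x.
    by rewrite mulr_ge0 ?exprn_ge0// ltW ?bincoef_gt0.
  - move=> x; apply: cvgM; first exact: cvg_cst.
    by have := binpoly_cvg b0 (v01 x); rewrite subKr.
have a1 : annihilator eps m tst (fun=> 1).
  split; first exact: bounded_measurable_cst.
  move=> [k w]; rewrite -[RHS](moments0 w); apply: eq_bigr => j _; congr (_ * _).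
  by apply: eq_Rintegral => x _; rewrite mul1r.
have [_ /(_ _ a1)[_]] := mh.
pose w0 : {ffun 'I_0 -> bool + 'I_n} := [ffun=> inl true].
move=> /(_ (existT _ 0%N w0)).
rewrite (_ : (fun _ => _) = \1_D); last first.
  apply/funext => x; rewrite /tst /test /monomial/= big_ord0 mulr1 mul1r /h -mulrA.
  rewrite /weight -/b /v0 -[X in X `^ _ * _]powR_inv1 ?(ltW (sqn1_gt0 _))// -powRrM.
  rewrite mulrNN mul1r powRN mulfV ?mulr1//.
  by rewrite gt_eqF// powR_gt0// sqn1_gt0.
move=> LD; rewrite -[RHS]LD; apply: eq_bigr => j _; congr (_ * _).
rewrite /Rintegral integral_indic// setIT; congr fine.
apply/eqP; rewrite eq_le; apply/andP; split; last first.
  by rewrite le_measure ?inE//; exact: subIsetl.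
have BK0 : m j (B `&` ~` K) = 0%E.
  apply/eqP; rewrite -measure_le0 -(m_K j) le_measure ?inE//; last exact: measurableC.
  by apply: measurableI => //; exact: measurableC.
rewrite -[X in (m j X <= _)%E](setIT B) -(setUv K) setIUr.
apply: le_trans (measureU2 _ _ _) _ => //.
  by apply: measurableI => //; exact: measurableC.
by rewrite [X in (_ + X <= _)%E]BK0 adde0.
Qed.

End energy_principle.

(** * Signed measures of nonpositive energy *)

Section energy_definite.
Context {R : realType} {n : nat} {J : finType}.
Variables (alpha : R) (eps : J -> R) (m : J -> radon R n) (K : set 'rV[R]_n).
Hypothesis alphan : alpha < n%:R.
Hypothesis tame_m : forall j, tame alpha (m j).

(** The energy is the sum over k of [bincoef b k] times a sum of squares of combined moments, so
    every square vanishes. *)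
Lemma energy_le0_moments :
  \sum_j \sum_l eps j * eps l * mutual alpha (m j) (m l) <= 0 ->
  forall k (w : {ffun 'I_k -> bool + 'I_n}), \sum_j eps j * moment alpha (m j) w = 0.
Proof.
move=> E0.
pose b := half_codim (n := n) alpha.
pose L k (w : {ffun 'I_k -> bool + 'I_n}) := \sum_j eps j * moment alpha (m j) w.
pose Q k := bincoef b k * \sum_(w : {ffun 'I_k -> bool + 'I_n}) L k w ^+ 2.
have b0 : 0 < b := half_codim_gt0 alphan.
have Q0 k : 0 <= Q k.
  rewrite mulr_ge0 ?(ltW (bincoef_gt0 _ _))// sumr_ge0// => w _.
  exact: sqr_ge0.
have QE k : Q k = \sum_j \sum_l eps j * eps l * eterm alpha k (m j) (m l).
  rewrite /Q /eterm -/b.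
  transitivity (\sum_j \sum_l \sum_(w : {ffun 'I_k -> bool + 'I_n})
      bincoef b k * (eps j * eps l * (moment alpha (m j) w * moment alpha (m l) w))).
    rewrite mulr_sumr.
    rewrite (eq_bigr (fun w => \sum_j \sum_l
      bincoef b k * (eps j * eps l * (moment alpha (m j) w * moment alpha (m l) w)))).
      by rewrite exchange_big/=; apply: eq_bigr => j _; rewrite exchange_big.
    move=> w _; rewrite expr2 /L big_distrlr/= mulr_sumr; apply: eq_bigr => j _.
    by rewrite mulr_sumr; apply: eq_bigr => l _; ring.
  apply: eq_bigr => j _; apply: eq_bigr => l _.
  by rewrite !mulr_sumr; apply: eq_bigr => w _; ring.
have mfin j : (m j setT < +oo)%E by case: (tame_m j).
have mutual_lim j l : series (fun k => eterm alpha k (m j) (m l)) N @[N --> \oo] -->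
    mutual alpha (m j) (m l).
  have [||c E] := @nneseries_EFin R (fun k => eterm alpha k (m j) (m l)).
  - by move=> k; exact: eterm_ge0.
  - by rewrite -energyE// -ge0_fin_numE ?energy_ge0// tame_energy_fin.
  by rewrite /mutual energyE// E; exact: c.
have Qlim : series Q N @[N --> \oo] --> \sum_j \sum_l eps j * eps l * mutual alpha (m j) (m l).
  rewrite (_ : (fun N => series Q N) = (fun N => \sum_j \sum_l eps j * eps l *
     series (fun k => eterm alpha k (m j) (m l)) N)); last first.
    apply/funext => N; rewrite /series/=.
    under eq_bigr do rewrite QE; rewrite exchange_big/=; apply: eq_bigr => j _.
    by rewrite exchange_big/=; apply: eq_bigr => l _; rewrite mulr_sumr.
  apply: (cvg_big _ (P := xpredT)); first exact: add_continuous.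
  move=> j _; apply: (cvg_big _ (P := xpredT)); first exact: add_continuous.
  by move=> l _; apply: cvgM; [exact: cvg_cst|exact: mutual_lim].
have ndQ : nondecreasing_seq (series Q).
  by apply/nondecreasing_seqP => k; rewrite /series/= big_nat_recr//= lerDl.
have Qk0 k : Q k = 0.
  apply/eqP; rewrite eq_le Q0 andbT; apply: le_trans E0; rewrite -(cvg_lim _ Qlim)//.
  apply: le_trans (nondecreasing_cvgn_le ndQ (cvgP _ Qlim) k.+1).
  by rewrite /series/= big_nat_recr//= lerDr sumr_ge0.
move=> k w; have /eqP := Qk0 k; rewrite mulf_eq0 (gt_eqF (bincoef_gt0 _ b0))/=.
rewrite psumr_eq0; last by move=> ? _; exact: sqr_ge0.
by move=> /allP/(_ w); rewrite mem_index_enum => /(_ isT); rewrite sqrf_eq0 => /eqP.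
Qed.

Lemma energy_definite : compact K -> (forall j, m j (~` K) = 0%E) ->
  \sum_j \sum_l eps j * eps l * mutual alpha (m j) (m l) <= 0 ->
  forall B, measurable B -> \sum_j eps j * fine (m j B) = 0.
Proof.
move=> cK mK E0 B mB; apply: (moments_determine alphan tame_m cK) => //.
exact: energy_le0_moments.
Qed.

End energy_definite.

(** * Minimization *)

Section vague_convergence.

Lemma cvg_initial (S : choiceType) (T : topologicalType) (h : S -> T)
    (F : set_system S) (s : S) : Filter F ->
  h @ F --> h s -> F --> (s : initial_topology h).
Proof.
move=> FF hF A [_ [[C oC <-] Cs] sCA]; rewrite nbhs_filterE; apply: filterS sCA _.
by apply: hF; exact: open_nbhs_nbhs.
Qed.

Lemma cvg_ptws (U : Type) (V : topologicalType) (F : set_system {ptws U -> V})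
    (h : {ptws U -> V}) : Filter F ->
  (forall t, g t @[g --> F] --> h t) -> F --> h.
Proof. by move=> FF hF; apply/cvg_sup => t; apply: cvg_initial => //; exact: hF. Qed.

Context {R : realType} {n : nat} {I : Type}.

Lemma cvg_vague (F : set_system {ptws I -> radon R n}) (lambda : {ptws I -> radon R n}) :
  Filter F ->
  (forall i (phi : test_function R n),
    (fun mu : {ptws I -> radon R n} => \int[mu i]_x phi x) @ F --> \int[lambda i]_x phi x) ->
  F --> lambda.
Proof.
move=> FF hF; apply: cvg_ptws => i; apply: cvg_initial; apply: cvg_ptws => phi.
exact: hF.
Qed.

Lemma bounded_measurable_test_function (phi : test_function R n) :
  bounded_measurable phi.
Proof.
split; first by apply: continuous_measurable_rV; exact: test_fun_continuous.
have [K0|/set0P Kn] := eqVneq (closure [set x | phi x != 0]) set0.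
  exists 0 => x; have [->|px] := eqVneq (phi x) 0; first by rewrite normr0.
  by have : closure [set x | phi x != 0] x by [apply: subset_closure]; rewrite K0.
have cont : continuous (fun x => `|phi x|).
  move=> x; apply: (@continuous_comp _ _ _ (phi : 'rV[R]_n -> R) (fun r : R => `|r|)).
    exact: test_fun_continuous.
  exact: norm_continuous.
have [x0 _ x0max] := compact_EVT_max Kn (@test_fun_compact R n phi) (continuous_subspaceT cont).
exists `|phi x0| => x; have [->|px] := eqVneq (phi x) 0; first by rewrite normr0.
by apply: x0max; rewrite inE; apply: subset_closure.
Qed.

End vague_convergence.

(** * Energies of constrained vector measures *)

Section weighted_energy.
Context {R : realType} {n : nat} {alpha : R} {I : finType}.
Variables (A : condenser n alpha I) (f : I -> 'rV[R]_n -> \bar R).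
Variable sigma : {ptws I -> radon R n}.
Hypothesis alphan : alpha < n%:R.
Hypothesis tame_sigma : forall i, tame alpha (sigma i).
Implicit Types (mu nu lambda : {ptws I -> radon R n}).

Local Notation s := (sgn A).

Definition constrained mu := forall i, dominated (mu i) (sigma i).

Lemma constrained_tame mu i : constrained mu -> tame alpha (mu i).
Proof. by move=> cmu; apply: (tame_dominated alphan (cmu i)). Qed.

Definition quadratic mu : R :=
  \sum_i \sum_j s i * s j * mutual alpha (mu i) (mu j).

Lemma vector_energyE mu : constrained mu -> vector_energy A mu = (quadratic mu)%:E.
Proof.
move=> cmu; rewrite /vector_energy /quadratic -sumEFin; apply: eq_bigr => i _.
rewrite -sumEFin; apply: eq_bigr => j _.
by rewrite (mutualE alphan (constrained_tame i cmu) (constrained_tame j cmu)).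
Qed.

Definition cross mu nu : R :=
  \sum_i \sum_j s i * s j * mutual alpha (mu i) (nu j).

Lemma crossC mu nu : constrained mu -> constrained nu -> cross mu nu = cross nu mu.
Proof.
move=> cmu cnu; rewrite /cross exchange_big; apply: eq_bigr => j _; apply: eq_bigr => i _.
by rewrite (mutualC alphan (constrained_tame _ cmu) (constrained_tame _ cnu)) [s j * _]mulrC.
Qed.

(** Bilinear expansion over the formal difference X - Y below; [split_sgn] turns the sums over
    plates of each sign into one signed sum. *)
Lemma strong_distE mu nu : constrained mu -> constrained nu ->
  strong_dist A mu nu = sqrte (cross mu mu + cross nu nu - 2 * cross mu nu)%:E.
Proof.
move=> cmu cnu.
have tmu i := constrained_tame i cmu; have tnu i := constrained_tame i cnu.
rewrite /strong_dist /energy_norm; congr sqrte.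
rewrite /signed_energy /signedB /resultant /=.
set X := radonD _ _; set Y := radonD _ _.
have tX : tame alpha X by apply: tameD => //; exact: tame_sum.
have tY : tame alpha Y by apply: tameD => //; exact: tame_sum.
have split_sgn (h : I -> R) : \sum_i s i * h i =
    \sum_(i | s i == 1) h i - \sum_(i | s i == -1) h i.
  rewrite (bigID (fun i => s i == 1))/=; congr (_ + _).
    by apply: eq_bigr => i /eqP ->; rewrite mul1r.
  have n11 : (1 == -1 :> R) = false by rewrite -subr_eq0 opprK -(natrD _ 1 1) pnatr_eq0.
  rewrite -sumrN (eq_bigl (fun i => s i == -1)); last first.
    by move=> i; case: (sgnP A i) => ->; rewrite eqxx ?n11// eq_sym n11.
  by apply: eq_bigr => i /eqP ->; rewrite mulN1r.
have diff eta : tame alpha eta -> mutual alpha X eta - mutual alpha Y eta =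
    \sum_i s i * (mutual alpha (mu i) eta - mutual alpha (nu i) eta).
  move=> teta; rewrite !mutualD//; try exact: tame_sum.
  rewrite !mutual_sum// split_sgn !sumrB; ring.
have diffC eta : tame alpha eta -> mutual alpha eta X - mutual alpha eta Y =
    \sum_i s i * (mutual alpha (mu i) eta - mutual alpha (nu i) eta).
  by move=> teta; rewrite -diff// !(mutualC alphan teta).
rewrite !(mutualE alphan)// -!EFinD; congr EFin.
transitivity ((mutual alpha X X - mutual alpha Y X) - (mutual alpha X Y - mutual alpha Y Y)).
  by ring.
rewrite !diff// -sumrB.
transitivity (\sum_i s i * (\sum_j s j * (mutual alpha (mu j) (mu i) - mutual alpha (nu j) (mu i))
  - \sum_j s j * (mutual alpha (mu j) (nu i) - mutual alpha (nu j) (nu i)))).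
  apply: eq_bigr => i _.
  by rewrite -!diffC//; ring.
rewrite (_ : 2 * cross mu nu = cross mu nu + cross nu mu); last first.
  by rewrite (crossC cnu cmu); ring.
rewrite /cross opprD -!sumrN -!big_split/=; apply: eq_bigr => i _.
rewrite -!sumrN -!big_split/= mulr_sumr; apply: eq_bigr => j _.
rewrite (mutualC alphan (tmu i) (tmu j)) (mutualC alphan (tnu i) (tnu j)).
rewrite (mutualC alphan (tmu i) (tnu j)) (mutualC alphan (tnu i) (tmu j)).
by ring.
Qed.

End weighted_energy.

(** * Convexity and lower semicontinuity of the weighted energy *)

Section minimization.
Context {R : realType} {n : nat} {alpha : R} {I : finType}.
Variables (A : condenser n alpha I) (f : I -> 'rV[R]_n -> \bar R).
Variables (a : I -> R) (g : I -> 'rV[R]_n -> R) (sigma : {ptws I -> radon R n}).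
Hypothesis alphan : alpha < n%:R.
Hypothesis tame_sigma : forall i, tame alpha (sigma i).
Hypothesis compact_plate : forall i, compact (plate A i).
Hypothesis support_sigma : forall i, msupport (sigma i) = plate A i.
Hypothesis weights_g : weights g.
Hypothesis measurable_f : forall i, measurable_fun setT (f i).
Hypothesis f_neg : forall i, (\int[sigma i]_x (f i)^\- x < +oo)%E.
Implicit Types (mu nu lambda : {ptws I -> radon R n}).

Local Notation s := (sgn A).
Local Notation constrained := (constrained sigma).
Local Notation weighted_energy := (weighted_energy A f).
Local Notation admissible := (admissible A f a g sigma).

Lemma measurable_g i : measurable_fun setT (fun x => (g i x)%:E).
Proof.
apply/measurable_EFinP; apply: continuous_measurable_rV.
by have [] := weights_g i.
Qed.

Lemma g_ge0 i x : (0 <= (g i x)%:E)%E.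
Proof. by rewrite lee_fin ltW//; have [] := weights_g i. Qed.

Lemma constrained_plate mu : constrained mu -> plate_measures A mu.
Proof.
move=> cmu i x mux; rewrite -support_sigma => U xU.
apply: (lt_le_trans (mux _ xU)); apply: cmu; apply: measurable_open.
by case: xU.
Qed.

Lemma constrained_null mu i : constrained mu -> mu i (~` plate A i) = 0%E.
Proof.
move=> cmu; apply/eqP; rewrite -measure_le0 -(msupportC_null (sigma i)) support_sigma.
by apply: cmu; apply: measurableC; exact: measurable_compact.
Qed.

(** The constraint already forces the supports and, since each sigma^i is tame, the finite
    energies. *)
Lemma admissibleP mu : admissible mu <-> [/\ constrained mu,
  weighted_energy mu \is a fin_num & forall i, (\int[mu i]_x (g i x)%:E)%E = (a i)%:E].
Proof.
split=> [[fe wfin cmu ga]|[cmu wfin ga]]; split => //; split.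
  exact: constrained_plate.
move=> i; have tmu := constrained_tame alphan tame_sigma i cmu.
by rewrite -ge0_fin_numE ?energy_ge0// tame_energy_fin.
Qed.

(** The two parts of the field behave differently: [f_neg] dominates the negative one, which is
    finite and converges; the positive one may be infinite and is only lower semicontinuous. *)
Definition fpos mu i := (\int[mu i]_x (f i)^\+ x)%E.
Definition fneg mu i := (\int[mu i]_x (f i)^\- x)%E.
Definition field_energy mu i : R := fine (fpos mu i) - fine (fneg mu i).

Lemma fpos_ge0 mu i : (0 <= fpos mu i)%E.
Proof. by apply: integral_ge0 => x _; rewrite funepos_ge0. Qed.

Lemma fneg_ge0 mu i : (0 <= fneg mu i)%E.
Proof. by apply: integral_ge0 => x _; rewrite funeneg_ge0. Qed.

Lemma fneg_fin mu i : constrained mu -> fneg mu i \is a fin_num.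
Proof.
move=> cmu; rewrite ge0_fin_numE ?fneg_ge0//; apply: le_lt_trans (f_neg i).
apply: ge0_le_measure_integral => //; first exact: cmu.
exact: measurable_funeneg.
Qed.

Lemma weighted_fin_fpos mu i : constrained mu ->
  weighted_energy mu \is a fin_num -> fpos mu i \is a fin_num.
Proof.
move=> cmu; rewrite /Defs.weighted_energy (vector_energyE A alphan tame_sigma cmu).
rewrite fin_numD => /andP[_ S2].
have : (\sum_i \int[mu i]_x f i x)%E \is a fin_num.
  move: S2; case: (\sum_i _)%E => [r| |] //.
    by rewrite gt0_muley ?lte_fin.
  by rewrite gt0_muleNy ?lte_fin.
move=> /sum_fin_numP /(_ i (mem_index_enum i) isT).
by rewrite integralE fin_numB => /andP[].
Qed.

Lemma weighted_energyE mu : constrained mu -> (forall i, fpos mu i \is a fin_num) ->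
  weighted_energy mu = (quadratic A mu + 2 * \sum_i field_energy mu i)%:E.
Proof.
move=> cmu pfin; rewrite /Defs.weighted_energy (vector_energyE A alphan tame_sigma cmu).
rewrite (_ : (\sum_i _)%E = (\sum_i field_energy mu i)%:E) ?EFinD ?EFinM//.
rewrite -sumEFin; apply: eq_bigr => i _.
by rewrite integralE EFinB /field_energy !fineK// fneg_fin.
Qed.

Definition midpoint mu nu : {ptws I -> radon R n} :=
  fun i => radonD (radonZ (2^-1)%:nng (mu i)) (radonZ (2^-1)%:nng (nu i)).

Lemma integral_midpoint mu nu i (h : 'rV[R]_n -> \bar R) :
  (forall x, (0 <= h x)%E) -> measurable_fun setT h ->
  (\int[midpoint mu nu i]_x h x =
   (2^-1)%:E * \int[mu i]_x h x + (2^-1)%:E * \int[nu i]_x h x)%E.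
Proof.
move=> h0 mh; rewrite ge0_integral_measure_add//.
by congr (_ + _)%E; exact: ge0_integral_mscale.
Qed.

Lemma constrained_midpoint mu nu : constrained mu -> constrained nu ->
  constrained (midpoint mu nu).
Proof.
move=> cmu cnu i B mB; rewrite [leLHS]measure_addE /= /mscale/=.
have -> : sigma i B = ((2^-1)%:E * sigma i B + (2^-1)%:E * sigma i B)%E.
  by rewrite -ge0_muleDl ?lee_fin// -EFinD -div1r -splitr mul1e.
by rewrite leeD// lee_wpmul2l ?lee_fin//; [exact: cmu|exact: cnu].
Qed.

(** The field terms are additive and homogeneous in the measure, so they cancel between the
    endpoints and the midpoint, leaving the identity for the energy alone. *)
Lemma parallelogram mu nu : admissible mu -> admissible nu ->
  admissible (midpoint mu nu) /\
  cross A mu mu + cross A nu nu - 2 * cross A mu nu =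
  2 * fine (weighted_energy mu) + 2 * fine (weighted_energy nu) -
  4 * fine (weighted_energy (midpoint mu nu)).
Proof.
move=> /admissibleP[cmu wmu ga_mu] /admissibleP[cnu wnu ga_nu].
have cmid := constrained_midpoint cmu cnu.
have pmu i := weighted_fin_fpos i cmu wmu; have pnu i := weighted_fin_fpos i cnu wnu.
have fposE i : fpos (midpoint mu nu) i =
    (2^-1 * fine (fpos mu i) + 2^-1 * fine (fpos nu i))%:E.
  rewrite /fpos integral_midpoint//; last exact: measurable_funepos.
  by rewrite -/(fpos mu i) -/(fpos nu i) EFinD !EFinM !fineK.
have fnegE i : fneg (midpoint mu nu) i =
    (2^-1 * fine (fneg mu i) + 2^-1 * fine (fneg nu i))%:E.
  rewrite /fneg integral_midpoint//; last exact: measurable_funeneg.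
  by rewrite -/(fneg mu i) -/(fneg nu i) EFinD !EFinM !fineK//; exact: fneg_fin.
have wmid := weighted_energyE cmid (fun i => etrans (congr1 _ (fposE i)) isT).
split.
  apply/admissibleP; split=> //; first by rewrite wmid.
  move=> i; rewrite integral_midpoint//; [|exact: g_ge0|exact: measurable_g].
  by rewrite ga_mu ga_nu -!EFinM -EFinD; congr EFin; field.
rewrite wmid !weighted_energyE//=.
have tmu i := constrained_tame alphan tame_sigma i cmu.
have tnu i := constrained_tame alphan tame_sigma i cnu.
have -> : \sum_i field_energy (midpoint mu nu) i =
    2^-1 * \sum_i field_energy mu i + 2^-1 * \sum_i field_energy nu i.
  rewrite !mulr_sumr -big_split/=; apply: eq_bigr => i _.
  by rewrite /field_energy fposE fnegE/=; ring.
have -> : quadratic A (midpoint mu nu) =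
    4^-1 * (cross A mu mu + cross A nu nu + cross A mu nu + cross A nu mu).
  rewrite /quadratic /cross -!big_split/= mulr_sumr; apply: eq_bigr => i _.
  rewrite -!big_split/= mulr_sumr; apply: eq_bigr => j _.
  have tZ (eta : radon R n) : tame alpha eta -> tame alpha (radonZ (2^-1)%:nng eta).
    exact: tameZ.
  have tmid k : tame alpha (midpoint mu nu k).
    by apply: tameD => //; exact: tZ.
  rewrite mutualD//; try exact: tZ.
  rewrite !mutualZ// !(mutualC alphan _ (tmid j))// !mutualD//; try exact: tZ.
  rewrite !mutualZ// !(mutualC alphan _ (tmu i))// !(mutualC alphan _ (tnu i))//=.
  by field.
rewrite (crossC A alphan tame_sigma cnu cmu) -[quadratic A mu]/(cross A mu mu).
by rewrite -[quadratic A nu]/(cross A nu nu); field.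
Qed.

Lemma integral_g_fin i : (\int[sigma i]_x (g i x)%:E < +oo)%E.
Proof.
have [x0 _ x0max] := compact_EVT_max (plate_nonempty A i) (@compact_plate i)
  (continuous_subspaceT (let: And3 _ c _ := weights_g i in c)).
apply: (@le_lt_trans _ _ (\int[sigma i]_x (g i x0)%:E)%E).
  apply: ae_ge0_le_integral => //.
  - by move=> x _; exact: g_ge0.
  - exact: measurable_g.
  - by move=> x _; exact: g_ge0.
  exists (~` plate A i); split.
  - by apply: measurableC; exact: measurable_compact.
  - by rewrite -support_sigma msupportC_null.
  move=> x /= H Ax; apply: H => _; rewrite lee_fin; apply: x0max.
  by rewrite inE.
rewrite integral_cst// lte_mul_pinfty// ?g_ge0//.
by case: (tame_sigma i).
Qed.

Lemma setwise_cvg_vague (F : set_system {ptws I -> radon R n}) lambda :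
  UltraFilter F -> F constrained -> constrained lambda ->
  (forall i B, measurable B ->
    (fun mu : {ptws I -> radon R n} => mu i B) @ F --> lambda i B) ->
  F --> lambda.
Proof.
move=> FU Fc cl lim_l; have FF := @ultra_proper _ _ FU.
apply: cvg_vague => i phi.
have sigma_fin : (sigma i setT < +oo)%E by case: (tame_sigma i).
have dom : \forall mu \near F, dominated (mu i) (sigma i).
  by apply: filterS Fc => mu; exact.
apply: (cvg_Rintegral_setwise FU sigma_fin dom (@cl i) (@lim_l i)).
exact: bounded_measurable_test_function.
Qed.

(** Setwise and vague convergence hold for any ultrafilter of admissible measures; only
    admissibility of the limit needs an energy bound along F, to keep the positive field part
    finite. *)
Lemma limit_admissible (F : set_system {ptws I -> radon R n}) :
  UltraFilter F -> F admissible -> exists lambda, [/\ F --> lambda,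
    forall i B, measurable B -> (fun mu : {ptws I -> radon R n} => mu i B) @ F --> lambda i B,
    constrained lambda &
    forall b : R, F [set mu | (weighted_energy mu <= b%:E)%E] ->
      admissible lambda /\ (weighted_energy lambda <= b%:E)%E].
Proof.
move=> FU Fad; have FF := @ultra_proper _ _ FU.
have Fc : \forall mu \near F, constrained mu.
  by apply: filterS Fad => mu /admissibleP[].
have dom i : \forall mu \near F, dominated (mu i) (sigma i).
  by apply: filterS Fc => mu; exact.
have sigma_fin i : (sigma i setT < +oo)%E by case: (tame_sigma i).
have /choice[lambda lambdaP] i : exists r : radon R n, forall B, measurable B ->
    (r B <= sigma i B)%E /\ (fun mu : {ptws I -> radon R n} => mu i B) @ F --> r B.
  have [r rP] := @setwise_limit _ _ _ _ F FU (fun mu => mu i) (sigma i) (sigma_fin i) (dom i).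
  have rc K : compact K -> (r K < +oo)%E.
    move=> cK; have [+ _] := rP K (measurable_compact cK).
    by move/le_lt_trans; apply; exact: radon_compact.
  by exists (Radon rc).
have cl : constrained lambda by move=> i B mB; have [] := lambdaP i B mB.
have lim_l i B : measurable B -> (fun mu : {ptws I -> radon R n} => mu i B) @ F --> lambda i B.
  by move=> mB; have [] := lambdaP i B mB.
exists lambda; split => //; first exact: setwise_cvg_vague.
move=> b Fb.
have cvg_mut i j : mutual alpha (mu i) (mu j) @[mu --> F] --> mutual alpha (lambda i) (lambda j).
  apply: fine_cvg; rewrite fineK; last first.
    by apply: tame_energy_fin => //; exact: (constrained_tame alphan tame_sigma).
  exact: (cvg_energy_setwise alphan FU (tame_sigma i) (tame_sigma j) (dom i) (dom j)
    (@cl i) (@cl j) (@lim_l i) (@lim_l j)).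
have cvg_quad : quadratic A mu @[mu --> F] --> quadratic A lambda.
  apply: (cvg_big _ (P := xpredT)); first exact: add_continuous.
  move=> i _; apply: (cvg_big _ (P := xpredT)); first exact: add_continuous.
  by move=> j _; apply: cvgM; [exact: cvg_cst|exact: cvg_mut].
have cvg_neg i : fine (fneg mu i) @[mu --> F] --> fine (fneg lambda i).
  apply: fine_cvg; rewrite fineK ?fneg_fin//.
  exact: (cvg_integral_setwise FU (dom i) (@cl i) (@lim_l i)
    (fun x => funeneg_ge0 (f i) x) (measurable_funeneg (@measurable_f i)) (f_neg i)).
have Fall : \forall mu \near F, [/\ constrained mu, forall i, fpos mu i \is a fin_num &
    quadratic A mu + 2 * \sum_i field_energy mu i <= b].
  near=> mu.
  have /admissibleP[cmu wmu _] : admissible mu by near: mu.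
  have pmu i := weighted_fin_fpos i cmu wmu.
  split=> //; rewrite -lee_fin -weighted_energyE//.
  by near: mu.
(* The bound b solved for the sum of the positive parts, with slack 1 in the quadratic part and in
   each negative part. *)
pose C : R := (b - quadratic A lambda + 1) / 2 + \sum_i (fine (fneg lambda i) + 1).
have near_neg : \forall mu \near F, forall k, fine (fneg mu k) <= fine (fneg lambda k) + 1.
  by apply: filter_forall => k; apply: (cvgr_le _ (cvg_neg k)); rewrite ltrDl.
have Fbound i : \forall mu \near F, `[0, C]%classic (fine (fpos mu i)).
  near=> mu; rewrite /= in_itv/=; have [_ pmu bmu] : [/\ constrained mu,
      forall i, fpos mu i \is a fin_num &
      quadratic A mu + 2 * \sum_i field_energy mu i <= b] by near: mu.
  have p0 k : 0 <= fine (fpos mu k) by rewrite fine_ge0// fpos_ge0.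
  rewrite p0/=; apply: (@le_trans _ _ (\sum_k fine (fpos mu k))).
    by rewrite (bigD1 i)//= lerDl sumr_ge0.
  have q1 : quadratic A lambda - 1 <= quadratic A mu.
    by near: mu; apply: (cvgr_ge _ cvg_quad); rewrite gtrBl.
  have n1 : \sum_k fine (fneg mu k) <= \sum_k (fine (fneg lambda k) + 1).
    have neg_mu : forall k, fine (fneg mu k) <= fine (fneg lambda k) + 1 by near: mu.
    by apply: ler_sum.
  by move: bmu; rewrite /field_energy sumrB /C; lra.
(* The limit exists by compactness of [0, C]; Fatou only places the positive part for lambda below
   it. *)
have /choice[l lP] i : exists l : R, fine (fpos mu i) @[mu --> F] --> l.
  by have [l _ ?] := ultra_compact_cvg FU (@segment_compact _ _ _) (Fbound i); exists l.
have pos_le i : (fpos lambda i <= (l i)%:E)%E.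
  apply/lee_addgt0Pr => e e0.
  apply: (integral_setwise_le FU (@lim_l i)) => //.
  - exact: measurable_funepos.
  - near=> mu; rewrite -/(fpos mu i) -(fineK (x := fpos mu i)).
      rewrite -EFinD lee_fin; near: mu; apply: (cvgr_le _ (lP i)).
      by rewrite ltrDl.
    by have [] : [/\ constrained mu, forall i, fpos mu i \is a fin_num &
      quadratic A mu + 2 * \sum_i field_energy mu i <= b] by near: mu.
have pos_fin i : fpos lambda i \is a fin_num.
  by rewrite ge0_fin_numE ?fpos_ge0// (le_lt_trans (pos_le i))// ltry.
have wb : (weighted_energy lambda <= b%:E)%E.
  rewrite weighted_energyE// lee_fin.
  apply: (@le_trans _ _ (quadratic A lambda + 2 * \sum_i (l i - fine (fneg lambda i)))).
    rewrite lerD2l ler_wpM2l//; apply: ler_sum => i _.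
    by rewrite lerD2r -lee_fin fineK.
  have cw : (quadratic A mu + 2 * \sum_i field_energy mu i) @[mu --> F] -->
      quadratic A lambda + 2 * \sum_i (l i - fine (fneg lambda i)).
    apply: cvgD => //; apply: cvgM; first exact: cvg_cst.
    apply: (cvg_big _ (P := xpredT)); first exact: add_continuous.
    by move=> i _; apply: cvgB; [exact: lP|exact: cvg_neg].
  rewrite -(cvg_lim _ cw)//; apply: limr_le; first exact: cvgP cw.
  by apply: filterS Fall => mu [].
split=> //; apply/admissibleP; split=> //; first by rewrite weighted_energyE.
move=> i.
have cg : (fun mu : {ptws I -> radon R n} => \int[mu i]_x (g i x)%:E)%E @ F --> (\int[lambda i]_x (g i x)%:E)%E.
  apply: (cvg_integral_setwise FU (dom i) (@cl i) (@lim_l i)).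
  - exact: g_ge0.
  - exact: measurable_g.
  - exact: integral_g_fin.
apply: (cvg_unique (@ereal_hausdorff R) cg) => /=.
apply: cvg_near_cst; apply: filterS Fad => mu amu.
by have [_ _ ->] := iffLR (admissibleP mu) amu.
Unshelve. all: by end_near. Qed.

End minimization.

(** * Measurability and integrability of the external field *)

Section fields.
Context {R : realType} {n : nat} {alpha : R} {I : finType}.
Hypothesis alphan : alpha < n%:R.
Implicit Types (f : I -> 'rV[R]_n -> \bar R).

Lemma case_I_field f (mu : radon R n) i : case_I f ->
  measurable_fun setT (f i) /\ (\int[mu]_x (f i)^\- x < +oo)%E.
Proof.
move=> /(_ i)[f0 lsc]; split.
  apply: (measurability (@ErealGenOInfty.G R)); first exact: ErealGenOInfty.measurableE.
  move=> _ [_ [r ->] <-]; rewrite setTI; apply: measurable_open.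
  have /lower_semicontinuousP/(_ r) := lsc.
  by congr open; apply/seteqP; split => x /=; rewrite in_itv/= andbT.
rewrite integral0_eq ?ltry// => x _.
by rewrite funenegE max_r// oppe_le0.
Qed.

(** The field is, up to sign, a difference of two potentials, each integrable for mu by
    [finite_energy_potential_integral]. *)
Lemma case_II_field (A : condenser n alpha I) f (mu : radon R n) (K : set 'rV[R]_n) i :
  tame alpha mu -> compact K -> mu (~` K) = 0%E -> case_II A f ->
  measurable_fun setT (f i) /\ (\int[mu]_x (f i)^\- x < +oo)%E.
Proof.
move=> tmu cK muK [zeta [[_ [z1 z2 _]] fE]].
have int_pot z : (energy alpha z z < +oo)%E -> mu.-integrable setT (potential alpha z).
  move=> zfin; apply/integrableP; split; first exact: measurable_potential_radon.
  under eq_integral do rewrite gee0_abs ?potential_ge0//.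
  exact: (finite_energy_potential_integral alphan tmu cK muK zfin).
have fint : mu.-integrable setT (f i).
  rewrite (funext (fE i)); apply: integrableZl => //.
  by apply: integrableB => //; exact: int_pot.
split; last exact: integral_funeneg_lt_pinfty.
by case/integrableP: fint.
Qed.

End fields.

Section null_sets.
Context {R : realType} {n : nat}.
Implicit Types (mu : radon R n) (B N : set 'rV[R]_n).

Lemma null_union mu (J : finType) (P : pred J) (N : J -> set 'rV[R]_n) :
  (forall j, P j -> measurable (N j) /\ mu (N j) = 0%E) ->
  measurable (\big[setU/set0]_(j | P j) N j) /\ mu (\big[setU/set0]_(j | P j) N j) = 0%E.
Proof.
move=> PN; apply: (big_ind (fun X : set 'rV[R]_n => measurable X /\ mu X = 0%E)) => //.
move=> X Y [mX X0] [mY Y0]; split; first exact: measurableU.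
by rewrite measureU0.
Qed.

Lemma measure_setD_null mu B N : measurable B -> measurable N -> mu N = 0%E ->
  mu (B `\` N) = mu B.
Proof.
move=> mB mN N0; apply/eqP; rewrite eq_le; apply/andP; split.
  by rewrite le_measure ?inE//; exact: measurableD.
have mBN : measurable (B `\` N) by exact: measurableD.
apply: (@le_trans _ _ (mu ((B `\` N) `|` N))).
  rewrite le_measure ?inE//; first exact: measurableU.
  by move=> x Bx; have [Nx|Nx] := pselect (N x); [right|left].
by rewrite measureU0.
Qed.

End null_sets.

(** * Solutions and minimizing sequences *)

Section solvability.
Context {R : realType} {n : nat} {alpha : R} {I : finType}.
Variables (A : condenser n alpha I) (f : I -> 'rV[R]_n -> \bar R).
Variables (a : I -> R) (g : I -> 'rV[R]_n -> R) (sigma : {ptws I -> radon R n}).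
Hypothesis alphan : alpha < n%:R.
Hypothesis tame_sigma : forall i, tame alpha (sigma i).
Hypothesis compact_plate : forall i, compact (plate A i).
Hypothesis support_sigma : forall i, msupport (sigma i) = plate A i.
Hypothesis weights_g : weights g.
Hypothesis measurable_f : forall i, measurable_fun setT (f i).
Hypothesis f_neg : forall i, (\int[sigma i]_x (f i)^\- x < +oo)%E.
Hypothesis admissible_nonempty : admissible A f a g sigma !=set0.
Implicit Types (mu : nat -> {ptws I -> radon R n}) (lambda : {ptws I -> radon R n}).

Local Notation admissible := (admissible A f a g sigma).
Local Notation weighted_energy := (weighted_energy A f).
Local Notation min_energy := (min_energy A f a g sigma).
Local Notation solutions := (solutions A f a g sigma).
Local Notation minimizing := (minimizing A f a g sigma).

Let limit_adm := @limit_admissible R n alpha I A f a g sigma alphan tame_sigma compact_plate support_sigma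
  weights_g measurable_f f_neg.
Let admP := @admissibleP R n alpha I A f a g sigma alphan tame_sigma support_sigma.

Lemma min_energy_le lambda : admissible lambda -> (min_energy <= weighted_energy lambda)%E.
Proof. by move=> al; apply: ge_ereal_inf; exists (weighted_energy lambda) => //; exists lambda. Qed.

(** Every real b above the infimum eventually bounds the energies, so by [limit_admissible] it
    bounds the energy of the limit. *)
Lemma minimizing_limit mu (F : set_system {ptws I -> radon R n}) :
  UltraFilter F -> mu @ \oo `<=` F -> minimizing mu ->
  exists2 lambda, solutions lambda & forall i B, measurable B ->
    (fun nu : {ptws I -> radon R n} => nu i B) @ F --> lambda i B.
Proof.
move=> FU muF [amu mulim].
have Fad : F admissible by apply: muF; exists 0%N => // k _; exact: amu.
have [lambda [_ lim_l cl wl]] := limit_adm FU Fad.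
have wle b : (min_energy < b%:E)%E -> admissible lambda /\ (weighted_energy lambda <= b%:E)%E.
  move=> mb; apply: wl; apply: muF; near=> k; apply: ltW.
  near: k; exact: (mulim _ (open_ereal_lt' mb)).
exists lambda => //.
have [b0 mb0] : exists b : R, (min_energy < b%:E)%E.
  have [nu anu] := admissible_nonempty; have [_ nufin _ _] := anu.
  exists (fine (weighted_energy nu) + 1).
  apply: le_lt_trans (min_energy_le anu) _.
  by rewrite -[ltLHS](fineK nufin) lte_fin ltrDl.
have [al _] := wle _ mb0; split => //; apply/eqP; rewrite eq_le min_energy_le// andbT.
have [_ lfin _ _] := al.
rewrite leNgt; apply/negP; rewrite -(fineK lfin) => H.
(* A real strictly between the infimum and the energy of the limit; the infimum -oo is covered by
   the same contradiction. *)
have [r r1 r2] : exists2 r : R, (min_energy < r%:E)%E & r < fine (weighted_energy lambda).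
  move: H; case: min_energy => [c| |] //; last first.
    by exists (fine (weighted_energy lambda) - 1); rewrite ?ltNyr// gtrBl.
  rewrite lte_fin => H; exists ((c + fine (weighted_energy lambda)) / 2).
    by rewrite lte_fin midf_lt.
  by rewrite midf_lt.
by have [_] := wle _ r1; rewrite -(fineK lfin) lee_fin leNgt r2.
Unshelve. all: by end_near. Qed.

Lemma exists_solution : solutions !=set0.
Proof.
have [|u uS ulim] := @ereal_inf_seq R [set weighted_energy mu | mu in admissible].
  by have [nu anu] := admissible_nonempty; apply/set0P; exists (weighted_energy nu); exists nu.
have /choice[mu muP] k : exists nu, admissible nu /\ weighted_energy nu = u k.
  by have [nu ? ?] := uS k; exists nu.
have [F [FU muF]] := ultraFilterLemma (fmap_proper_filter mu (@eventually_filter)).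
have [|lambda sl _] := @minimizing_limit mu F FU muF; last by exists lambda.
split=> [k|]; first by have [] := muP k.
by under eq_fun do rewrite (muP _).2.
Qed.

(** All solutions have the same energy, so [limit_admissible] applies with b equal to the
    minimum. *)
Lemma compact_solutions : compact solutions.
Proof.
rewrite compact_ultra => F FU Fs; have FF := @ultra_proper _ _ FU.
have Fad : F admissible by apply: filterS Fs => nu [].
have [lambda [Fl _ cl wl]] := limit_adm FU Fad.
have [nu [anu nuE]] := exists_solution; have [_ nufin _ _] := anu.
exists lambda; split => //.
have [|al wll] := wl (fine (weighted_energy nu)).
  by apply: filterS Fs => eta [_ etaE] /=; rewrite fineK// etaE nuE.
split => //; apply/eqP; rewrite eq_le min_energy_le// andbT.
by rewrite -nuE -(fineK nufin).
Qed.

(** The midpoint is admissible, so its energy is at least the infimum. *)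
Lemma dist_le_gap lambda eta : solutions lambda -> admissible eta ->
  cross A eta eta + cross A lambda lambda - 2 * cross A eta lambda <=
  2 * (fine (weighted_energy eta) - fine min_energy).
Proof.
move=> [al lE] aeta.
have [amid ->] := parallelogram alphan tame_sigma support_sigma weights_g measurable_f f_neg aeta al.
have [_ lfin _ _] := al; have [_ midfin _ _] := amid.
have : fine min_energy <= fine (weighted_energy (midpoint eta lambda)).
  by rewrite fine_le// -?lE// lE; exact: min_energy_le.
by rewrite lE; lra.
Qed.

Lemma minimizing_strong_cvg mu lambda : minimizing mu -> solutions lambda ->
  strong_dist A (mu k) lambda @[k --> \oo] --> 0%E.
Proof.
move=> [amu mulim] sl; have [al lE] := sl; have [_ lfin _ _] := al.
have [cl _ _] := iffLR (admP lambda) al.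
have cmu k : constrained sigma (mu k) by have [] := iffLR (admP (mu k)) (amu k).
have mfin : min_energy \is a fin_num by rewrite -lE.
under eq_fun do rewrite (strong_distE A alphan tame_sigma)//.
apply: cvg_EFin; first exact: nearW.
apply: (@squeeze_cvgr _ _ _ _ (cst 0)
    (fun k => Num.sqrt (2 * (fine (weighted_energy (mu k)) - fine min_energy)))).
- by apply: nearW => k; rewrite /= sqrtr_ge0/= ler_wsqrtr// dist_le_gap.
- exact: cvg_cst.
have c : 2 * (fine (weighted_energy (mu k)) - fine min_energy) @[k --> \oo] -->
    2 * (fine min_energy - fine min_energy).
  apply: cvgM; first exact: cvg_cst.
  apply: cvgB; last exact: cvg_cst.
  by apply: fine_cvg; rewrite fineK.
have := cvg_comp _ _ c (@sqrt_continuous R _).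
by rewrite subrr mulr0 sqrtr0.
Qed.

Let constrained_plateI lambda i : constrained sigma lambda -> lambda i (~` plate A i) = 0%E.
Proof. exact: (constrained_null compact_plate support_sigma). Qed.

(** The components of eta and the negated ones of lambda, indexed by I + I and weighted by the
    signs, form a signed measure of energy at most 0, which therefore vanishes. Off the
    intersections of plates, which tame measures do not charge, a single plate contributes. *)
Lemma solutions_eq_measure (eta lambda : {ptws I -> radon R n}) :
  (forall i j, i != j -> capacity alpha (plate A i `&` plate A j) = 0%E) ->
  solutions eta -> solutions lambda ->
  forall i B, measurable B -> eta i B = lambda i B.
Proof.
move=> disj se sl i B mB.
have [ae eE] := se; have [al lE] := sl.
have [ce _ _] := iffLR (admP eta) ae; have [cl _ _] := iffLR (admP lambda) al.
have te k := constrained_tame alphan tame_sigma k ce.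
have tl k := constrained_tame alphan tame_sigma k cl.
pose eps (j : I + I) : R := match j with inl j => sgn A j | inr j => - sgn A j end.
pose m (j : I + I) : radon R n := match j with inl j => eta j | inr j => lambda j end.
pose K : set 'rV[R]_n := \big[setU/set0]_(j : I) plate A j.
have cK : compact K by apply: bigsetU_compact.
have mplate j : measurable (plate A j) by exact: measurable_compact.
have subK j : plate A j `<=` K by rewrite /K (bigD1 j)//=; exact: subsetUl.
have tm j : tame alpha (m j) by case: j.
have mK j : m j (~` K) = 0%E.
  have null (nu : {ptws I -> radon R n}) k : constrained sigma nu -> nu k (~` K) = 0%E.
    move=> cnu; apply/eqP; rewrite -measure_le0 -(constrained_plateI k cnu).
    rewrite le_measure ?inE//; last exact: subsetC.
      by apply: measurableC; exact: measurable_compact.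
    exact: measurableC.
  by case: j => k; exact: null.
have := @energy_definite R n (I + I)%type alpha eps m K alphan tm cK mK.
have E0 : \sum_j \sum_k eps j * eps k * mutual alpha (m j) (m k) <= 0.
  have := dist_le_gap sl ae; rewrite eE subrr mulr0; apply: le_trans.
  rewrite big_sumType/=.
  under eq_bigr do rewrite big_sumType/=.
  under [X in _ + X]eq_bigr do rewrite big_sumType/=.
  rewrite !big_split/=.
  rewrite (_ : 2 * cross A eta lambda = cross A eta lambda + cross A lambda eta); last first.
    by rewrite (crossC A alphan tame_sigma cl ce); ring.
  rewrite /cross opprD -!sumrN -!big_split/=.
  apply: ler_sum => j _; rewrite -!sumrN -!big_split/=; apply: ler_sum => k _.
  by rewrite le_eqVlt; apply/orP; left; apply/eqP; ring.
move=> /(_ E0) def.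
(* Null for eta^i and lambda^i; off N only the components of index i have mass. *)
pose N := ~` plate A i `|` \big[setU/set0]_(j | j != i) (plate A i `&` plate A j).
have null (nu : {ptws I -> radon R n}) : constrained sigma nu ->
    measurable N /\ nu i N = 0%E.
  move=> cnu; have tnu := constrained_tame alphan tame_sigma i cnu.
  have [|mU U0] := @null_union R n (nu i) I (fun j => j != i)
      (fun j => plate A i `&` plate A j).
    move=> j ji; have mij : measurable (plate A i `&` plate A j) by exact: measurableI.
    by split => //; apply: (capacity0_null alphan tnu mij); apply: disj; rewrite eq_sym.
  split; first by apply: measurableU => //; exact: measurableC.
  by rewrite measureU0//; [exact: constrained_plateI|exact: measurableC].
have [mN eN] := null _ ce; have [_ lN] := null _ cl.
pose B' := B `\` N.
have mB' : measurable B' by exact: measurableD.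
have other (nu : {ptws I -> radon R n}) j : constrained sigma nu -> j != i -> nu j B' = 0%E.
  move=> cnu ji; apply/eqP; rewrite -measure_le0 -(constrained_plateI j cnu).
  rewrite le_measure ?inE//; first exact: measurableC.
  move=> x [Bx Nx] Ajx; apply: Nx; have [Aix|Aix] := pselect (plate A i x); [right|by left].
  by rewrite (bigD1 j)//=; left.
rewrite -(measure_setD_null mB mN eN) -(measure_setD_null mB mN lN) -/B'.
have := def B' mB'; rewrite big_sumType/= (bigD1 i)//= big1 ?addr0; last first.
  by move=> j ji; rewrite (other _ _ ce ji)/= mulr0.
rewrite (bigD1 i)//= big1 ?addr0; last first.
  by move=> j ji; rewrite (other _ _ cl ji)/= mulr0.
have fin (nu : radon R n) : tame alpha nu -> nu B' \is a fin_num.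
  by move=> [nuT _]; rewrite ge0_fin_numE// (le_lt_trans _ nuT)// le_measure ?inE.
move=> /eqP; rewrite mulNr subr_eq0 => /eqP.
have s0 : sgn A i != 0 by case: (sgnP A i) => ->; rewrite ?oppr_eq0 oner_eq0.
move=> /(mulfI s0) E.
by rewrite -(fineK (fin _ (te i))) -(fineK (fin _ (tl i))) E.
Qed.

(** If a neighbourhood N were missed infinitely often, an ultrafilter on the missed indices would
    have a solution as setwise limit. Its components agree with those of lambda on Borel sets, so
    the ultrafilter converges vaguely to lambda too and must contain N. *)
Lemma minimizing_vague_cvg mu lambda :
  (forall i j, i != j -> capacity alpha (plate A i `&` plate A j) = 0%E) ->
  minimizing mu -> solutions lambda -> mu k @[k --> \oo] --> lambda.
Proof.
move=> disj mmu sl N lN; apply: contrapT => NN.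
pose D := [set k | ~ N (mu k)].
have GP : ProperFilter (within D \oo).
  apply: Build_ProperFilter => H; apply: NN.
  by case: H => m _ Hm; exists m => // k mk; apply: contrapT => /(Hm k mk).
have [F [FU GF]] := ultraFilterLemma (fmap_proper_filter mu GP).
have muF : mu @ \oo `<=` F.
  by move=> P [m _ mP]; apply: GF; exists m => // k mk _; exact: mP.
have FN : F (~` N) by apply: GF; exists 0%N.
have [eta se lim_eta] := minimizing_limit FU muF mmu.
have Fc : F (constrained sigma).
  apply: muF; exists 0%N => // k _.
  by have [] := iffLR (admP (mu k)) (mmu.1 k).
have [cl _ _] := iffLR (admP lambda) sl.1.
have Fl : F --> lambda.
  apply: (setwise_cvg_vague tame_sigma FU Fc cl) => i B mB.
  by rewrite -(solutions_eq_measure disj se sl i mB); exact: lim_eta.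
have FF := @ultra_proper _ _ FU.
have F0 : F set0 by rewrite -(setICr N); exact: (@filterI _ F _ N (~` N) (Fl _ lN) FN).
by have := @filter_not_empty _ F FF F0.
Qed.

End solvability.

Theorem theorem6p1 (R : realType) (n : nat) (alpha : R) (I : finType)
    (A : condenser n alpha I) (f : I -> 'rV[R]_n -> \bar R)
    (a : I -> R) (g : I -> 'rV[R]_n -> R) (sigma : {ptws I -> radon R n})
    (hn : (3 <= n)%N) (halpha : 0 < alpha < n%:R)
    (hA : forall i, compact (plate A i))
    (hf : case_I f \/ case_II A f)
    (ha : forall i, 0 < a i) (hg : weights g)
    (hsigma : constraints A a g sigma)
    (hpot : forall i,
      (forall x, plate A i x -> potential alpha (sigma i) x \is a fin_num) /\
      {within plate A i, continuous (potential alpha (sigma i))})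
    (hne : admissible A f a g sigma !=set0) :
  [/\ solutions A f a g sigma !=set0,
      compact (solutions A f a g sigma) &
      forall mu : nat -> {ptws I -> radon R n}, minimizing A f a g sigma mu ->
      forall lambda : {ptws I -> radon R n}, solutions A f a g sigma lambda ->
        strong_dist A (mu k) lambda @[k --> \oo] --> 0%E /\
        ((forall i j, i != j ->
            capacity alpha (plate A i `&` plate A j) = 0%E) ->
         mu k @[k --> \oo] --> lambda)].
Proof.
have /andP[_ alphan] := halpha.
have supp i : msupport (sigma i) = plate A i by have [_ /(_ i)[]] := hsigma.
have null i : sigma i (~` plate A i) = 0%E by rewrite -supp msupportC_null.
have tame_sigma i : tame alpha (sigma i).
  have [fin cont] := hpot i.
  exact: (tame_of_continuous alphan (hA i) (plate_nonempty A i) (null i) fin cont).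
have field i : measurable_fun setT (f i) /\ (\int[sigma i]_x (f i)^\- x < +oo)%E.
  case: hf => [|] hf; first exact: case_I_field.
  exact: (case_II_field alphan i (tame_sigma i) (hA i) (null i) hf).
have mf i := (field i).1; have fneg i := (field i).2.
split.
- exact: (exists_solution alphan tame_sigma hA supp hg mf fneg hne).
- exact: (compact_solutions alphan tame_sigma hA supp hg mf fneg hne).
move=> mu mmu lambda sl; split.
  exact: (minimizing_strong_cvg alphan tame_sigma supp hg mf fneg mmu sl).
by move=> disj; exact: (minimizing_vague_cvg alphan tame_sigma hA supp hg mf fneg hne disj mmu sl).
Qed.
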